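(* Let $\Omega\subset\mathbb{R}^n$ be a bounded domain with regular boundary, $p>0$, $\lambda,\kappa,\gamma>0$, $\alpha,\beta\in\mathbb{R}$. Let $\mu\ge\gamma$ and let $N$ be a positive integer large enough that $\lambda_{N+1}>\frac{\gamma}{\lambda}$. Put $\omega=2(\lambda-\gamma\lambda_{N+1}^{-1})\lambda_1$. Consider sufficiently smooth complex-valued solutions $u$ of $$u_t-(\lambda+i\alpha)\Delta u+(\kappa+i\beta)|u|^p u-\gamma u=-\mu\sum_{k=1}^{N}(u,\omega_k)\,\omega_k,\quad x\in\Omega,\ t>0,$$ $$u=0\ \text{ on }\partial\Omega,\ t>0,\qquad u(x,0)=u_0(x),\quad x\in\Omega.$$ (i) If $p<4/n$, then for every such solution $u$ and every $\delta$ with $0<\delta<\omega$ there exists $C>0$ (which may depend on $u_0$ and $\delta$) such that $$\|\nabla u(t)\|_{L^2(\Omega)}^2\le C e^{-\delta t}\|\nabla u_0\|_{L^2(\Omega)}^2\quad\text{for all } t\ge0.$$ (ii) If $p=4/n$, the same conclusion holds provided $\|u_0\|_{L^2(\Omega)}$ is sufficiently small; that is, there exists $\eta>0$, independent of the solution, such that for every such solution $u$ with $\|u_0\|_{L^2(\Omega)}\le\eta$ and every $0<\delta<\omega$ there exists $C>0$ such that $\|\nabla u(t)\|_{L^2(\Omega)}^2\le C e^{-\delta t}\|\nabla u_0\|_{L^2(\Omega)}^2$ for all $t\ge0$.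
   Context: $(\cdot,\cdot)$ is the inner product $(f,g)=\int_\Omega f\bar g\,dx$ of $L^2(\Omega)$. $(\omega_k)_{k\ge1}$ is an orthonormal basis of $L^2(\Omega)$ consisting of eigenfunctions of $-\Delta$ with homogeneous Dirichlet boundary condition, with corresponding eigenvalues $0<\lambda_1\le\lambda_2\le\cdots$, $\lambda_k\to\infty$, counted with multiplicity. (The parameter $\lambda$ without index is a coefficient of the equation, and $\omega$ without index is a decay rate.) ''Regular boundary'' means smooth enough (e.g. $C^2$) for the elliptic estimate $\|v\|_{H^2(\Omega)}\le C\|\Delta v\|_{L^2(\Omega)}$ on $H^2(\Omega)\cap H^1_0(\Omega)$ and the usual Gagliardo-Nirenberg inequalities to hold. The existence of the solution is assumed. ''Sufficiently smooth'' means regular enough in time and space that one may multiply the equation by $\bar u$ and by $-\Delta\bar u$, integrate over $\Omega$, integrate by parts (including in the nonlinear term) and differentiate $\|u(t)\|_{L^2}^2$ and $\|\nabla u(t)\|_{L^2}^2$ in time; for definiteness one may take $u\in C([0,\infty);H^2(\Omega)\cap H^1_0(\Omega))\cap C^1([0,\infty);H^1_0(\Omega))$ with $|u(t)|^pu(t)\in H^1_0(\Omega)$ for all $t$. *)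

(* Defs.v *)
From HB Require Import structures.
From mathcomp Require Import all_boot all_order all_algebra.
From mathcomp Require Import all_classical all_reals all_analysis.
From mathcomp Require Import complex.
Set Implicit Arguments.
Unset Strict Implicit.
Unset Printing Implicit Defensive.
Import Order.TTheory GRing.Theory Num.Theory.
Import numFieldNormedType.Exports.
Import ComplexField.Normc.
Local Open Scope classical_set_scope.
Local Open Scope ring_scope.
(* The sigma-algebra generated by the coordinates, as MathComp-Analysis does for
   n.-tuple; by [open_measurable_rV] below it is the Borel sigma-algebra. *)
Definition rV_display : measure_display. Proof. exact. Qed.

Section rV_measurable.
Variables (R : realType) (n : nat).

Definition rVcoord (i : 'I_n) (x : 'rV[R]_n) : measurableTypeR R := x ord0 i.

Let rV_set0 : g_sigma_preimage rVcoord set0.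
Proof. exact: sigma_algebra0. Qed.

Let rV_setC A : g_sigma_preimage rVcoord A -> g_sigma_preimage rVcoord (~` A).
Proof. exact: sigma_algebraC. Qed.

Let rV_bigcup (F : (set 'rV[R]_n)^nat) :
  (forall i, g_sigma_preimage rVcoord (F i)) ->
  g_sigma_preimage rVcoord (\bigcup_i (F i)).
Proof. exact: sigma_algebra_bigcup. Qed.

HB.instance Definition _ := @isMeasurable.Build rV_display
  'rV[R]_n (g_sigma_preimage rVcoord) rV_set0 rV_setC rV_bigcup.

Lemma measurable_rVcoord i : measurable_fun [set: 'rV[R]_n] (rVcoord i).
Proof.
move=> _ Y mY; rewrite setTI; apply: sub_sigma_algebra => /=.
rewrite -bigcup_seq/=; exists i => /=; first by rewrite mem_index_enum.
by exists Y => //; rewrite setTI.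
Qed.

Lemma measurable_fun_rV d (T : measurableType d) (f : T -> 'rV[R]_n) :
  (forall i, measurable_fun [set: T] (rVcoord i \o f)) ->
  measurable_fun [set: T] f.
Proof.
move=> mf; move=> _ A mA; rewrite setTI.
suff : @measurable _ 'rV[R]_n `<=` [set B | measurable (f @^-1` B)] by exact.
apply: smallest_sub.
  split => /=.
  - by rewrite preimage_set0.
  - by move=> B /= mB; rewrite setTD -preimage_setC; exact: measurableC.
  - by move=> F mF /=; rewrite preimage_bigcup; exact: bigcup_measurable.
move=> B; rewrite -bigcup_seq => -[i _ [C mC <-]] /=.
by rewrite setTI -comp_preimage -[X in measurable X]setTI; exact: mf.
Qed.

End rV_measurable.

Section lebesgue_rV.
Variable R : realType.

Definition rVcons n (p : measurableTypeR R * 'rV[R]_n) : 'rV[R]_n.+1 :=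
  \row_i (if unlift ord0 i is Some j then p.2 ord0 j else p.1).

Definition rVuncons n (x : 'rV[R]_n.+1) : measurableTypeR R * 'rV[R]_n :=
  (x ord0 ord0, \row_j x ord0 (lift ord0 j)).

Lemma rVconsK n : cancel (@rVcons n) (@rVuncons n).
Proof.
case=> a y; rewrite /rVuncons mxE unlift_none; congr pair.
by apply/rowP => j; rewrite !mxE liftK.
Qed.

Lemma measurable_rVcons n : measurable_fun setT (@rVcons n).
Proof.
apply: measurable_fun_rV => i.
case: (unliftP ord0 i) => [j|] ->.
- rewrite (_ : _ \o _ = rVcoord j \o snd).
    exact: measurableT_comp (measurable_rVcoord j) measurable_snd.
  by apply/funext => p /=; rewrite /rVcoord mxE liftK.
- rewrite (_ : _ \o _ = fst) //.
  by apply/funext => p /=; rewrite /rVcoord mxE unlift_none.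
Qed.

Lemma measurable_rVuncons n : measurable_fun setT (@rVuncons n).
Proof.
apply: measurable_fun_pair.
  exact: measurable_rVcoord.
apply: measurable_fun_rV => i.
rewrite (_ : _ \o _ = rVcoord (lift ord0 i)); first exact: measurable_rVcoord.
by apply/funext => x; rewrite /= /rVcoord mxE.
Qed.

Section cons_measure.
Variables (n : nat) (m : {sigma_finite_measure set 'rV[R]_n -> \bar R}).

Definition cons_measure : set 'rV[R]_n.+1 -> \bar R :=
  pushforward (lebesgue_measure \x m)%E (@rVcons n).

Let cons_measure0 : cons_measure set0 = 0%E.
Proof. by rewrite /cons_measure /pushforward preimage_set0 measure0. Qed.

Let cons_measure_ge0 A : (0 <= cons_measure A)%E.
Proof. by rewrite /cons_measure /pushforward; exact: measure_ge0. Qed.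

Let cons_measure_sigma_additive : semi_sigma_additive cons_measure.
Proof.
move=> F mF tF mUF; rewrite /cons_measure /pushforward preimage_bigcup.
apply: measure_semi_sigma_additive.
- by move=> k; rewrite -[X in measurable X]setTI; exact: measurable_rVcons.
- apply/trivIsetP => /= i j _ _ ij; rewrite -preimage_setI.
  by move/trivIsetP : tF => /(_ _ _ _ _ ij) ->//; rewrite preimage_set0.
- rewrite -preimage_bigcup -[X in measurable X]setTI.
  exact: measurable_rVcons.
Qed.

HB.instance Definition _ := isMeasure.Build _ _ _ cons_measure
  cons_measure0 cons_measure_ge0 cons_measure_sigma_additive.

Let cons_measure_sigma_finite : sigma_finite setT cons_measure.
Proof.
have /sigma_finiteP[F [FT ndF Foo]] := sigma_finiteT (@lebesgue_measure R).
have /sigma_finiteP[G [GT ndG Goo]] := sigma_finiteT m.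
exists (fun k => @rVuncons n @^-1` (F k `*` G k)).
  rewrite -preimage_bigcup (_ : \bigcup_k _ = setT) ?preimage_setT//.
  apply/seteqP; split=> // -[x y] _.
  have [i _ Fx] : (\bigcup_k F k) x by rewrite -FT.
  have [j _ Gy] : (\bigcup_k G k) y by rewrite -GT.
  exists (maxn i j) => //; split => /=.
  - by move: x Fx; exact/subsetPset/ndF/leq_maxl.
  - by move: y Gy; exact/subsetPset/ndG/leq_maxr.
move=> k; have [mF Fk] := Foo k; have [mG Gk] := Goo k; split.
  rewrite -[X in measurable X]setTI; apply: measurable_rVuncons => //.
  exact: measurableX.
rewrite /cons_measure /pushforward -comp_preimage.
rewrite (_ : _ \o _ = id) ?preimage_id; last first.
  by apply/funext => p; rewrite /= rVconsK.
by rewrite product_measure1E// lte_mul_pinfty// ge0_fin_numE.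
Qed.

HB.instance Definition _ := Measure_isSigmaFinite.Build _ _ _ cons_measure
  cons_measure_sigma_finite.

End cons_measure.

(* n-fold product of the one-dimensional Lebesgue measure, see
   [lebesgue_rV_box]. *)
Fixpoint lebesgue_rV n : {sigma_finite_measure set 'rV[R]_n -> \bar R} :=
  if n is n'.+1 then cons_measure (lebesgue_rV n')
  else \d_(0 : 'rV[R]_0).

End lebesgue_rV.

Section lebesgue_rV_theory.
Variable R : realType.

Lemma measurable_rVbox n (A : 'I_n -> set (measurableTypeR R)) :
  (forall i, measurable (A i)) ->
  measurable [set x : 'rV[R]_n | forall i, A i (rVcoord i x)].
Proof.
move=> mA.
rewrite (_ : mkset _ = \bigcap_(i in [set: 'I_n]) (rVcoord i @^-1` A i)).
  apply: fin_bigcap_measurable => // i _.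
  by rewrite -[X in measurable X]setTI; exact: measurable_rVcoord.
by apply/seteqP; split=> [x Ax i _|x Ax i]; [exact: Ax|exact: Ax].
Qed.

Lemma open_measurable_rV n (U : set 'rV[R]_n) : open U -> measurable U.
Proof.
move=> oU.
pose cube (q : {ffun 'I_n -> rat * rat}) : set 'rV[R]_n :=
  [set x | forall i, rVcoord i x \in `](ratr (q i).1 : R), ratr (q i).2[].
pose F q := if `[< cube q `<=` U >] then cube q else set0.
have -> : U = \bigcup_q F q.
  apply/seteqP; split=> [x Ux|x [q _]]; last first.
    by rewrite /F; case: asboolP => // qU; exact: qU.
  have /nbhs_ballP[r /= r0 xrU] : nbhs x U by exact: open_nbhs_nbhs.
  have qP i : exists q : rat * rat,
      [/\ ratr q.1 \in `](x ord0 i - r), (x ord0 i)[ &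
          ratr q.2 \in `](x ord0 i), (x ord0 i + r)[].
    have [|a ax] := @rat_in_itvoo R (x ord0 i - r) (x ord0 i).
      by rewrite ltrBlDr ltrDl.
    have [|b bx] := @rat_in_itvoo R (x ord0 i) (x ord0 i + r).
      by rewrite ltrDl.
    by exists (a, b).
  have [q {}qP] := choice qP.
  exists [ffun i => q i] => //; rewrite /F asboolT.
    move=> i; rewrite ffunE in_itv/=.
    have [] := qP i; rewrite !in_itv/= => /andP[_ ->] /andP[-> _] //.
  move=> y qy; apply: xrU; split=> // i j; rewrite ord1.
  have := qy j; rewrite ffunE /rVcoord in_itv/= => /andP[qy1 qy2].
  have [] := qP j; rewrite !in_itv/= => /andP[q1 q1'] /andP[q2 q2'].
  rewrite /ball/= ltr_norml; apply/andP; split.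
    by rewrite ltrBrDl ltrBlDr (lt_trans qy2).
  by rewrite ltrBlDr addrC -ltrBlDr (lt_trans q1).
apply: countable_bigcupT_measurable => // q.
rewrite /F; case: asboolP => // _.
apply: (@measurable_rVbox n
  (fun i => [set` `](ratr (q i).1 : R), ratr (q i).2[])).
by move=> i; exact: measurable_itv.
Qed.

Lemma lebesgue_rV_box n (A : 'I_n -> set (measurableTypeR R)) :
  (forall i, measurable (A i)) ->
  lebesgue_rV R n [set x | forall i, A i (rVcoord i x)] =
  (\prod_(i < n) lebesgue_measure (A i))%E.
Proof.
elim: n A => [|n IH] A mA.
  rewrite big_ord0 /= diracE mem_set//.
  by case.
rewrite big_ord_recl /= /cons_measure /pushforward -IH; last by move=> i.
rewrite -product_measure1E//; last first.
  by apply: (@measurable_rVbox n (fun i => A (lift ord0 i))) => i; exact: mA.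
congr (product_measure1 _ _ _); apply/seteqP; split=> -[a y] /=.
- move=> H; split; first by have := H ord0; rewrite /rVcoord mxE unlift_none.
  by move=> i; have := H (lift ord0 i); rewrite /rVcoord mxE liftK.
- move=> [Aa Ay] i; rewrite /rVcoord mxE.
  by case: (unliftP ord0 i) => [j|] ->; rewrite ?liftK ?unlift_none//; exact: Ay.
Qed.

End lebesgue_rV_theory.

Section sobolev.
Variables (R : realType) (n : nat) (Omega : set 'rV[R]_n).
Local Open Scope complex_scope.
Implicit Types (f g v : 'rV[R]_n -> R[i]) (phi : 'rV[R]_n -> R) (j : 'I_n).

(* Functions on Omega are functions on the whole space whose values outside
   Omega are never used; elements of L^2(Omega) are not quotiented by equality
   almost everywhere. [Lp_norm] is extended-real; [L2norm] is meaningful for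
   [in_L2] functions only. *)
Definition Lp_norm (s : R) f : \bar R :=
  'N[lebesgue_rV R n]_s%:E[(fun x => (normc (f x))%:E) \_ Omega].

Definition L2norm f : R := fine (Lp_norm 2 f).

Definition in_L2 f :=
  [/\ measurable_fun Omega (fun x => complex.Re (f x)),
      measurable_fun Omega (fun x => complex.Im (f x)) &
      (Lp_norm 2 f < +oo)%E].

Definition cintegral f : R[i] :=
  (\int[lebesgue_rV R n]_(x in Omega) complex.Re (f x)) +i*
  (\int[lebesgue_rV R n]_(x in Omega) complex.Im (f x)).

Definition inner f g : R[i] := cintegral (fun x => f x * (g x)^*).

Definition partial j phi : 'rV[R]_n -> R := 'D_(delta_mx ord0 j) phi.

Definition partials (s : seq 'I_n) phi : 'rV[R]_n -> R := foldr partial phi s.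

(* C^infinity: all iterated partial derivatives exist and are continuous. *)
Definition smooth phi := forall s : seq 'I_n,
  continuous (partials s phi) /\
  forall x j, derivable (partials s phi) x (delta_mx ord0 j).

Definition test_fun phi := smooth phi /\
  exists K : set 'rV[R]_n,
    [/\ compact K, K `<=` Omega & forall x, ~ K x -> phi x = 0].

(* Real test functions suffice: the two sides are complex-linear. *)
Definition weak_partial j f g := forall phi, test_fun phi ->
  cintegral (fun x => f x * (partial j phi x)%:C) =
  - cintegral (fun x => g x * (phi x)%:C).

(* A representative of the weak partial derivative, which is unique almost
   everywhere; 0 if there is no weak partial derivative in L^2(Omega). *)
Definition wpartial j f : 'rV[R]_n -> R[i] :=
  xget (fun=> 0) [set g | in_L2 g /\ weak_partial j f g].

Definition in_H1 f := in_L2 f /\ forall j, exists g, in_L2 g /\ weak_partial j f g.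

Definition grad_norm f : R := Num.sqrt (\sum_j L2norm (wpartial j f) ^+ 2).

Definition H1norm f : R := Num.sqrt (L2norm f ^+ 2 + grad_norm f ^+ 2).

(* H^1_0: the closure in H^1 of the complex-valued test functions
   phi + i psi. *)
Definition in_H10 f := in_H1 f /\ forall eps : R, 0 < eps ->
  exists phi psi, [/\ test_fun phi, test_fun psi &
    H1norm (fun x => f x - (phi x +i* psi x)) < eps].

Definition in_H2 f := in_H1 f /\ forall j, in_H1 (wpartial j f).

Definition H2norm f : R :=
  Num.sqrt (H1norm f ^+ 2 +
            \sum_i \sum_j L2norm (wpartial i (wpartial j f)) ^+ 2).

Definition laplacian f : 'rV[R]_n -> R[i] :=
  fun x => \sum_j wpartial j (wpartial j f) x.

Definition bounded_domain :=
  [/\ open Omega, connected Omega, Omega !=set0 & bounded_set Omega].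

Definition elliptic_estimate := exists C : R, forall v, in_H2 v -> in_H10 v ->
  H2norm v <= C * L2norm (laplacian v).

(* The Gagliardo-Nirenberg interpolation between L^2 and H^2,
     |v|_{L^s} <= C |v|_{H^2}^theta |v|_{L^2}^(1 - theta),
     1/s = 1/2 - 2 theta/n, 2 <= s < oo, 0 <= theta < 1,
   required only for functions satisfying the Dirichlet condition. *)
Definition gagliardo_nirenberg := forall s theta : R,
  2 <= s -> theta = n%:R / 2 * (2^-1 - s^-1) -> theta < 1 ->
  exists C : R, forall v, in_H2 v -> in_H10 v ->
    (Lp_norm s v <= (C * H2norm v `^ theta * L2norm v `^ (1 - theta))%:E)%E.

(* Regularity of the boundary enters through these two estimates only; both hold
   for bounded domains of class C^2. *)
Definition regular_boundary := elliptic_estimate /\ gagliardo_nirenberg.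

(* Weak form of - Laplacian f = l f in Omega, f = 0 on the boundary. *)
Definition dirichlet_eigenpair (l : R) f := in_H10 f /\
  forall v, in_H10 v ->
    \sum_j inner (wpartial j f) (wpartial j v) = l%:C * inner f v.

Definition orthonormal_basis (e : nat -> 'rV[R]_n -> R[i]) :=
  [/\ forall k, in_L2 (e k),
      forall k l, inner (e k) (e l) = (k == l)%:R &
      forall f, in_L2 f ->
        L2norm (fun x => f x - \sum_(k < m) inner f (e k) * e k x)
          @[m --> \oo] --> (0 : R)].

(* Indices start at 0: [ev k] and [e k] are the (k+1)-st eigenvalue and
   eigenfunction. *)
Definition dirichlet_eigenbasis (ev : nat -> R) (e : nat -> 'rV[R]_n -> R[i]) :=
  [/\ orthonormal_basis e, forall k, dirichlet_eigenpair (ev k) (e k),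
      0 < ev 0%N, {homo ev : k l / (k <= l)%N >-> k <= l} &
      ev @ \oo --> +oo].

(* Continuity and differentiability on [0, +oo) in the norm [nrm]; the limits at
   0 are one-sided. *)
Definition continuous_in (nrm : ('rV[R]_n -> R[i]) -> R)
    (v : R -> 'rV[R]_n -> R[i]) :=
  forall t : R, 0 <= t ->
    nrm (fun x => v s x - v t x) @[s --> within [set s | 0 <= s] (nbhs t)]
      --> (0 : R).

Definition derivative_in (nrm : ('rV[R]_n -> R[i]) -> R)
    (v dv : R -> 'rV[R]_n -> R[i]) :=
  forall t : R, 0 <= t ->
    nrm (fun x => (s - t)^-1%:C * (v s x - v t x) - dv t x)
      @[s --> within [set s | 0 <= s] t^'] --> (0 : R).

(* u in C([0, oo); H^2 cap H^1_0) cap C^1([0, oo); H^1_0), |u|^p u in H^1_0,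
   satisfying the controlled equation for every t > 0 and almost every x in
   Omega; the boundary condition is membership in H^1_0. *)
Definition cgl_solution (p lambda alpha kappa beta gamma mu : R) (N : nat)
    (e : nat -> 'rV[R]_n -> R[i]) (u0 : 'rV[R]_n -> R[i])
    (u : R -> 'rV[R]_n -> R[i]) :=
  let nonlin t := fun x => (normc (u t x) `^ p)%:C * u t x in
  [/\ forall t : R, 0 <= t -> in_H2 (u t) /\ in_H10 (u t),
      continuous_in H2norm u,
      forall t : R, 0 <= t -> in_H10 (nonlin t),
      in_L2 u0 /\ u 0 = u0 %[ae lebesgue_rV R n in Omega] &
      exists ut : R -> 'rV[R]_n -> R[i],
        [/\ forall t : R, 0 <= t -> in_H10 (ut t),
            continuous_in H1norm ut, derivative_in H1norm u ut &
            forall t : R, 0 < t ->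
            \forall x \ae lebesgue_rV R n, Omega x ->
              ut t x - (lambda +i* alpha) * laplacian (u t) x
                + (kappa +i* beta) * nonlin t x - gamma%:C * u t x
              = - (mu%:C * \sum_(k < N) inner (u t) (e k) * e k x)]].

End sobolev.

(* Main.v *)
(** Testing the equation with [u] gives [(|u|^2)' <= - omega |u|^2]: the control
    compensates [gamma] on the first N modes, and on the remaining ones
    [gamma |v|^2 <= (gamma / lambda_(N+1)) |grad v|^2].  Testing with [- Delta u]
    and splitting the modes in the same way gives
      [(|grad u|^2)' <= - 2 (lambda - gamma / lambda_(N+1) - K |u|^p) |Delta u|^2];
    the nonlinear term is estimated by the Gagliardo-Nirenberg inequality, in which
    the H^2 norm occurs to the power [np/4 <= 1], and the missing power of
    [|Delta u|] is supplied by the Poincare inequality.  As [|u|] tends to 0, the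
    bracket eventually exceeds [delta / (2 lambda_1)], after which [|grad u|^2]
    decays at the rate [delta]; before that time it is bounded by continuity,
    which suffices since the constant may depend on the solution. *)
Require Import Defs.
From mathcomp Require Import all_boot all_order all_algebra.
From mathcomp Require Import all_classical all_reals all_analysis.
From mathcomp Require Import measurable_realfun complex.
From mathcomp Require Import ring lra.
Import Order.TTheory GRing.Theory Num.Theory.
Import numFieldNormedType.Exports.
Import ComplexField.Normc.
Set Implicit Arguments.
Unset Strict Implicit.
Unset Printing Implicit Defensive.
Local Open Scope classical_set_scope.
Local Open Scope ring_scope.

(** In the gradient estimate the nonlinear term has no sign for general [beta], so it can only be
    absorbed. Interpolation is homogeneous of degree p+1 and puts at most one power on the H^2 norm;
    raising that power to exactly one turns the term into a multiple of |u|^p |Delta u|^2, the same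
    quadratic quantity as the dissipation, with a coefficient that vanishes with |u|. Hence the L^2
    decay, where the sign of [kappa] disposes of the nonlinearity, has to be available before the
    gradient is treated. Two features of the setting shape the rest. Weak derivatives are chosen
    representatives, so their linearity rests on uniqueness almost everywhere, hence on test
    functions separating L^2. And eigenfunction series are never differentiated: the spectral
    inequalities come from pairing [laplacian u] in L^2 with the expansion of [u]. *)

Section complex_parts.
Variable R : rcfType.
Local Open Scope complex_scope.
Implicit Types x y : R[i].

Lemma cReD x y : complex.Re (x + y) = complex.Re x + complex.Re y.
Proof. by case: x; case: y. Qed.

Lemma cImD x y : complex.Im (x + y) = complex.Im x + complex.Im y.
Proof. by case: x; case: y. Qed.

Lemma cReN x : complex.Re (- x) = - complex.Re x.
Proof. by case: x. Qed.

Lemma cImN x : complex.Im (- x) = - complex.Im x.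
Proof. by case: x. Qed.

Lemma cReM x y : complex.Re (x * y) =
  complex.Re x * complex.Re y - complex.Im x * complex.Im y.
Proof. by case: x; case: y. Qed.

Lemma cImM x y : complex.Im (x * y) =
  complex.Re x * complex.Im y + complex.Im x * complex.Re y.
Proof. by case: x; case: y. Qed.

Lemma cReJ x : complex.Re x^* = complex.Re x.
Proof. by case: x. Qed.

Lemma cImJ x : complex.Im x^* = - complex.Im x.
Proof. by case: x. Qed.

Lemma complex_ext x y :
  complex.Re x = complex.Re y -> complex.Im x = complex.Im y -> x = y.
Proof. by case: x; case: y => ? ? ? ? /= -> ->. Qed.

Lemma normc_ge0 x : 0 <= normc x.
Proof. by case: x => a b; exact: sqrtr_ge0. Qed.

Lemma sqr_normcE x : normc x ^+ 2 = complex.Re x ^+ 2 + complex.Im x ^+ 2.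
Proof. by case: x => a b /=; rewrite sqr_sqrtr// addr_ge0 ?sqr_ge0. Qed.

Lemma normr_Re_le_normc x : `|complex.Re x| <= normc x.
Proof. by case: x => a b; rewrite -sqrtr_sqr ler_wsqrtr//= lerDl sqr_ge0. Qed.

End complex_parts.

(** * Square-integrable functions *)

Section square_integrable.
Context d (T : measurableType d) (R : realType).
Variables (mu : {measure set T -> \bar R}) (D : set T) (mD : measurable D).
Implicit Types a b : T -> R.

Definition sq_integrable a :=
  measurable_fun D a /\ mu.-integrable D (EFin \o (fun x => a x ^+ 2)).

(** The product is dominated by [a^2 + b^2]. *)
Lemma sq_integrableM a b : sq_integrable a -> sq_integrable b ->
  mu.-integrable D (EFin \o (fun x => a x * b x)).
Proof.
move=> [ma ia] [mb ib].
have iab := integrableD mD ia ib.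
apply: (le_integrable mD _ _ iab).
  by apply/measurable_EFinP; exact: measurable_funM.
move=> x Dx /=; rewrite lee_fin ler_norml.
have -> : `|a x ^+ 2 + b x ^+ 2| = a x ^+ 2 + b x ^+ 2.
  by rewrite ger0_norm// addr_ge0// sqr_ge0.
have := sqr_ge0 (a x + b x); have := sqr_ge0 (a x - b x).
have := sqr_ge0 (a x); have := sqr_ge0 (b x).
by move=> ? ? ? ?; apply/andP; split; nra.
Qed.

Lemma sq_integrableZ (c : R) a : sq_integrable a ->
  sq_integrable (fun x => c * a x).
Proof.
move=> [ma ia]; split; first exact: measurable_funM.
rewrite (_ : _ \o _ = fun x => ((c ^+ 2)%:E * (a x ^+ 2)%:E)%E).
  exact: integrableZl.
by apply/funext => x /=; rewrite exprMn EFinM.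
Qed.

Lemma sq_integrableD a b : sq_integrable a -> sq_integrable b ->
  sq_integrable (fun x => a x + b x).
Proof.
move=> ha hb; split; first by apply: measurable_funD; [exact: ha.1|exact: hb.1].
have := integrableD mD (integrableD mD ha.2 hb.2)
  (integrableZl mD 2 (sq_integrableM ha hb)).
apply: eq_integrable => // x _ /=; rewrite -EFinM -!EFinD; congr EFin; ring.
Qed.

End square_integrable.

(** * Inner product and norm of complex-valued square-integrable functions *)

Section L2_theory.
Variables (R : realType) (n : nat) (Omega : set 'rV[R]_n).
Hypothesis mO : measurable Omega.
Local Open Scope complex_scope.
Local Notation mu := (lebesgue_rV R n).
Local Notation inner := (inner Omega).
Local Notation L2norm := (L2norm Omega).
Local Notation in_L2 := (in_L2 Omega).
Local Notation Re := (@complex.Re R).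
Local Notation Im := (@complex.Im R).
Implicit Types (f g v w : 'rV[R]_n -> R[i]).

Definition cintegrable f :=
  mu.-integrable Omega (EFin \o (fun x => Re (f x))) /\
  mu.-integrable Omega (EFin \o (fun x => Im (f x))).

Lemma cintegralD f g : cintegrable f -> cintegrable g ->
  cintegral Omega (fun x => f x + g x) = cintegral Omega f + cintegral Omega g.
Proof.
move=> [rf jf] [rg jg]; apply: complex_ext; rewrite (cReD, cImD) /=.
- by rewrite -RintegralD//; apply: eq_Rintegral => x _; rewrite cReD.
- by rewrite -RintegralD//; apply: eq_Rintegral => x _; rewrite cImD.
Qed.

Lemma cintegralZ (c : R[i]) f : cintegrable f ->
  cintegral Omega (fun x => c * f x) = c * cintegral Omega f.
Proof.
move=> [rf jf]; apply: complex_ext; rewrite (cReM, cImM) /=.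
- rewrite -!RintegralZl// -RintegralB//=.
  + by apply: eq_Rintegral => x _; rewrite cReM.
  + exact: (integrableZl mO _ rf).
  + exact: (integrableZl mO _ jf).
- rewrite -!RintegralZl// -RintegralD//=.
  + by apply: eq_Rintegral => x _; rewrite cImM.
  + exact: (integrableZl mO _ jf).
  + exact: (integrableZl mO _ rf).
Qed.

Lemma cintegralJ f : cintegrable f ->
  cintegral Omega (fun x => (f x)^*) = (cintegral Omega f)^*.
Proof.
move=> [rf jf]; apply: complex_ext; rewrite (cReJ, cImJ) /=.
- by apply: eq_Rintegral => x _; rewrite cReJ.
- rewrite -[RHS]mulN1r -RintegralZl//.
  by apply: eq_Rintegral => x _; rewrite cImJ mulN1r.
Qed.

(** Outside [Omega] the truncated function is 0, and [s != 0] makes its power vanish there. *)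
Lemma Lp_normE (s : R) f : s != 0 -> Lp_norm Omega s f =
  ((\int[mu]_(x in Omega) (normc (f x) `^ s)%:E) `^ s^-1)%E.
Proof.
move=> s0; rewrite /Lp_norm unlock; congr (_ `^ _)%E.
rewrite [RHS]integral_mkcond; apply: eq_integral => x _ /=.
rewrite !patchE; case: ifPn => _ /=.
  by rewrite ger0_norm ?normc_ge0.
by rewrite normr0 powR0.
Qed.

Lemma in_L2E f : in_L2 f <->
  sq_integrable mu Omega (Re \o f) /\ sq_integrable mu Omega (Im \o f).
Proof.
have key : measurable_fun Omega (fun x => Re (f x)) ->
    measurable_fun Omega (fun x => Im (f x)) ->
    ((Lp_norm Omega 2 f < +oo)%E <->
    mu.-integrable Omega (EFin \o (fun x => normc (f x) ^+ 2))).
  move=> mr mi.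
  have mn : measurable_fun Omega (fun x => normc (f x) ^+ 2).
    under eq_fun do rewrite sqr_normcE.
    by apply: measurable_funD; exact: measurable_funX.
  rewrite Lp_normE//; split => [h|/integrableP[_ h]].
    apply/integrableP; split; first exact/measurable_EFinP.
    rewrite (@eq_integral _ _ _ _ _ (fun x => (normc (f x) `^ 2)%:E)); last first.
      by move=> x _ /=; rewrite ger0_norm ?sqr_ge0// -powR_mulrn ?normc_ge0.
    move: h; set I := (\int[_]_(_ in _) _)%E; have : (0 <= I)%E.
      by apply: integral_ge0 => x _; rewrite lee_fin powR_ge0.
    (* An infinite integral would have an infinite root, contradicting the finite norm. *)
    by case: I => [r _ _|_|//]; rewrite ?ltry//= invr_eq0 pnatr_eq0.
  move: h; rewrite (@eq_integral _ _ _ _ _ (fun x => (normc (f x) `^ 2)%:E));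
    last first.
    by move=> x _ /=; rewrite ger0_norm ?sqr_ge0// -powR_mulrn ?normc_ge0.
  set I := (\int[_]_(_ in _) _)%E; have : (0 <= I)%E.
    by apply: integral_ge0 => x _; rewrite lee_fin powR_ge0.
  by case: I => [r _ _|_|//]; rewrite ?ltry//= ltxx.
split=> [[mr mi /(key mr mi) h]|[[mr ir] [mi ii]]].
  split; split => //=; apply: (le_integrable mO _ _ h).
  - by apply/measurable_EFinP; exact: measurable_funX.
  - move=> x _ /=; rewrite lee_fin ger0_norm ?sqr_ge0// ger0_norm ?sqr_ge0//.
    by rewrite sqr_normcE lerDl sqr_ge0.
  - by apply/measurable_EFinP; exact: measurable_funX.
  - move=> x _ /=; rewrite lee_fin ger0_norm ?sqr_ge0// ger0_norm ?sqr_ge0//.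
    by rewrite sqr_normcE lerDr sqr_ge0.
split=> //; apply/key => //.
have := integrableD mO ir ii; apply: eq_integrable => // x _ /=.
by rewrite -EFinD sqr_normcE.
Qed.

Lemma in_L2_eq f g : f =1 g -> in_L2 f -> in_L2 g.
Proof. by move=> /funext ->. Qed.

Lemma in_L2D f g : in_L2 f -> in_L2 g -> in_L2 (fun x => f x + g x).
Proof.
move=> /in_L2E[rf jf] /in_L2E[rg jg]; apply/in_L2E; split.
- rewrite (_ : _ \o _ = fun x => Re (f x) + Re (g x)).
    exact: (sq_integrableD mO).
  by apply/funext => x /=; rewrite cReD.
- rewrite (_ : _ \o _ = fun x => Im (f x) + Im (g x)).
    exact: (sq_integrableD mO).
  by apply/funext => x /=; rewrite cImD.
Qed.

Lemma in_L2Z (c : R[i]) f : in_L2 f -> in_L2 (fun x => c * f x).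
Proof.
move=> /in_L2E[rf jf]; apply/in_L2E; split.
- rewrite (_ : _ \o _ = fun x => Re c * Re (f x) + - Im c * Im (f x)).
    by apply: (sq_integrableD mO); exact: (sq_integrableZ mO).
  by apply/funext => x /=; rewrite cReM mulNr.
- rewrite (_ : _ \o _ = fun x => Re c * Im (f x) + Im c * Re (f x)).
    by apply: (sq_integrableD mO); exact: (sq_integrableZ mO).
  by apply/funext => x /=; rewrite cImM.
Qed.

Lemma in_L2N f : in_L2 f -> in_L2 (fun x => - f x).
Proof. by move=> /(in_L2Z (-1)); apply: in_L2_eq => x; rewrite mulN1r. Qed.

Lemma in_L2B f g : in_L2 f -> in_L2 g -> in_L2 (fun x => f x - g x).
Proof. by move=> hf /in_L2N; exact: in_L2D. Qed.

Lemma in_L2_0 : in_L2 (fun=> 0).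
Proof.
have h : sq_integrable mu Omega (fun=> 0 : R).
  split; first exact: measurable_cst.
  rewrite (_ : _ \o _ = cst 0%E); first exact: integrable0.
  by apply/funext => x /=; rewrite expr0n.
by apply/in_L2E; split.
Qed.

Lemma in_L2_sum (I : Type) (r : seq I) (P : pred I) (F : I -> 'rV[R]_n -> R[i]) :
  (forall i, in_L2 (F i)) -> in_L2 (fun x => \sum_(i <- r | P i) F i x).
Proof.
move=> hF; elim: r => [|i r IH].
  by apply: in_L2_eq in_L2_0 => x; rewrite big_nil.
case: (boolP (P i)) => Pi.
  by apply: in_L2_eq (in_L2D (hF i) IH) => x; rewrite big_cons Pi.
by apply: in_L2_eq IH => x; rewrite big_cons (negbTE Pi).
Qed.

Lemma in_L2J f : in_L2 f -> in_L2 (fun x => (f x)^*).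
Proof.
move=> /in_L2E[rf jf]; apply/in_L2E; split.
- by rewrite (_ : _ \o _ = Re \o f)//; apply/funext => x /=; rewrite cReJ.
- rewrite (_ : _ \o _ = fun x => (-1) * Im (f x)).
    exact: (sq_integrableZ mO).
  by apply/funext => x /=; rewrite cImJ mulN1r.
Qed.

Lemma cintegrableM f g : in_L2 f -> in_L2 g -> cintegrable (fun x => f x * g x).
Proof.
move=> /in_L2E[rf jf] /in_L2E[rg jg]; split.
- have := integrableB mO (sq_integrableM mO rf rg) (sq_integrableM mO jf jg).
  by apply: eq_integrable => // x _ /=; rewrite cReM.
- have := integrableD mO (sq_integrableM mO rf jg) (sq_integrableM mO jf rg).
  by apply: eq_integrable => // x _ /=; rewrite cImM.
Qed.

Lemma innerDl f g v : in_L2 f -> in_L2 g -> in_L2 v ->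
  inner (fun x => f x + g x) v = inner f v + inner g v.
Proof.
move=> hf hg /in_L2J hv; rewrite /inner -cintegralD; do ?exact: cintegrableM.
by congr cintegral; apply/funext => x; rewrite mulrDl.
Qed.

Lemma innerZl c f v : in_L2 f -> in_L2 v ->
  inner (fun x => c * f x) v = c * inner f v.
Proof.
move=> hf /in_L2J hv; rewrite /inner -cintegralZ; do ?exact: cintegrableM.
by congr cintegral; apply/funext => x; rewrite mulrA.
Qed.

Lemma innerC f g : in_L2 f -> in_L2 g -> inner f g = (inner g f)^*.
Proof.
move=> hf hg; rewrite /inner -cintegralJ.
  by congr cintegral; apply/funext => x; rewrite rmorphM /= conjcK mulrC.
exact: cintegrableM hg (in_L2J hf).
Qed.

Lemma innerNl f v : in_L2 f -> in_L2 v ->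
  inner (fun x => - f x) v = - inner f v.
Proof.
move=> hf hv; rewrite -mulN1r -innerZl//; congr inner.
by apply/funext => x; rewrite mulN1r.
Qed.

Lemma innerBl f g v : in_L2 f -> in_L2 g -> in_L2 v ->
  inner (fun x => f x - g x) v = inner f v - inner g v.
Proof. by move=> hf hg hv; rewrite innerDl ?innerNl//; exact: in_L2N. Qed.

Lemma innerDr f g v : in_L2 f -> in_L2 g -> in_L2 v ->
  inner v (fun x => f x + g x) = inner v f + inner v g.
Proof.
move=> hf hg hv; rewrite innerC ?innerDl//; last exact: in_L2D.
by rewrite rmorphD /= [inner v f]innerC// [inner v g]innerC.
Qed.

Lemma innerZr c f v : in_L2 f -> in_L2 v ->
  inner v (fun x => c * f x) = c^* * inner v f.
Proof.
move=> hf hv; rewrite innerC ?innerZl//; last exact: in_L2Z.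
by rewrite rmorphM /= [inner v f]innerC.
Qed.

Lemma innerNr f v : in_L2 f -> in_L2 v ->
  inner v (fun x => - f x) = - inner v f.
Proof.
move=> hf hv; rewrite innerC ?innerNl//; last exact: in_L2N.
by rewrite rmorphN /= [inner v f]innerC.
Qed.

Lemma innerBr f g v : in_L2 f -> in_L2 g -> in_L2 v ->
  inner v (fun x => f x - g x) = inner v f - inner v g.
Proof. by move=> hf hg hv; rewrite innerDr ?innerNr//; exact: in_L2N. Qed.

Lemma inner0l v : in_L2 v -> inner (fun=> 0) v = 0.
Proof.
move=> hv; rewrite -[RHS](mul0r (inner (fun=> 0) v)) -innerZl//.
  by congr inner; apply/funext => x; rewrite mul0r.
exact: in_L2_0.
Qed.

Lemma inner_suml (I : Type) (r : seq I) (F : I -> 'rV[R]_n -> R[i]) v :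
  (forall i, in_L2 (F i)) -> in_L2 v ->
  inner (fun x => \sum_(i <- r) F i x) v = \sum_(i <- r) inner (F i) v.
Proof.
move=> hF hv; elim: r => [|i r IH].
  rewrite big_nil (_ : (fun _ => _) = fun=> 0) ?inner0l//.
  by apply/funext => x; rewrite big_nil.
rewrite big_cons -IH -innerDl//; last exact: in_L2_sum.
by congr inner; apply/funext => x; rewrite big_cons.
Qed.

Lemma inner_sumr (I : Type) (r : seq I) (F : I -> 'rV[R]_n -> R[i]) v :
  (forall i, in_L2 (F i)) -> in_L2 v ->
  inner v (fun x => \sum_(i <- r) F i x) = \sum_(i <- r) inner v (F i).
Proof.
move=> hF hv; rewrite innerC//; last exact: in_L2_sum.
rewrite inner_suml// rmorph_sum; apply: eq_bigr => i _.
by rewrite [RHS]innerC.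
Qed.

Lemma L2norm_ge0 f : 0 <= L2norm f.
Proof. by rewrite /L2norm fine_ge0// Lnorm_ge0. Qed.

(** [fine] sends an infinite norm to 0; the finiteness in [in_L2] is what ties [L2norm] to the
    integral. *)
Lemma sqr_L2norm_int f : in_L2 f ->
  L2norm f ^+ 2 = \int[mu]_(x in Omega) (normc (f x) ^+ 2).
Proof.
move=> [mr mi foo].
rewrite -powR_mulrn ?L2norm_ge0// /L2norm -[LHS]/(fine (fine _ `^ 2)%:E).
rewrite -poweR_EFin fineK; last by rewrite ge0_fin_numE ?Lnorm_ge0.
rewrite Lp_normE// -poweRrM mulVf// poweRe1; last first.
  by apply: integral_ge0 => x _; rewrite lee_fin powR_ge0.
congr fine; apply: eq_integral => x _.
by rewrite -powR_mulrn ?normc_ge0.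
Qed.

Lemma inner_diag f : in_L2 f -> inner f f = (L2norm f ^+ 2)%:C.
Proof.
move=> hf; rewrite sqr_L2norm_int//; apply: complex_ext => /=.
- apply: eq_Rintegral => x _; rewrite cReM cReJ cImJ sqr_normcE; ring.
- rewrite (@eq_Rintegral _ _ _ mu Omega (fun=> 0)) ?Rintegral_cst ?mul0r// => x _.
  rewrite cImM cReJ cImJ; ring.
Qed.

Lemma sqr_L2normE f : in_L2 f -> L2norm f ^+ 2 = Re (inner f f).
Proof. by move=> /inner_diag ->. Qed.

Lemma Re_inner_sym f g : in_L2 f -> in_L2 g -> Re (inner f g) = Re (inner g f).
Proof. by move=> hf hg; rewrite innerC// cReJ. Qed.

Lemma sqr_L2normD f g : in_L2 f -> in_L2 g ->
  L2norm (fun x => f x + g x) ^+ 2 =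
  L2norm f ^+ 2 + 2 * Re (inner f g) + L2norm g ^+ 2.
Proof.
move=> hf hg; have hD := in_L2D hf hg.
rewrite !sqr_L2normE// innerDl// !innerDr// !cReD (Re_inner_sym hg hf); ring.
Qed.

Lemma L2normZ (c : R) f : in_L2 f -> L2norm (fun x => c%:C * f x) = `|c| * L2norm f.
Proof.
move=> hf; apply: (@pexpIrn _ 2) => //; rewrite ?nnegrE ?mulr_ge0 ?L2norm_ge0//.
rewrite exprMn real_normK ?num_real// !sqr_L2normE//; last exact: in_L2Z.
rewrite innerZl ?innerZr//; last exact: in_L2Z.
by rewrite !(cReM, cImM) cReJ cImJ /=; ring.
Qed.

(** Cauchy-Schwarz from the nonnegativity of [|f + t g|^2] for every real [t]; each case below picks
    a suitable [t]. *)
Lemma Re_inner_le f g : in_L2 f -> in_L2 g ->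
  Re (inner f g) <= L2norm f * L2norm g.
Proof.
move=> hf hg; have h (t : R) :
    0 <= L2norm f ^+ 2 + 2 * t * Re (inner f g) + t ^+ 2 * L2norm g ^+ 2.
  have := sqr_ge0 (L2norm (fun x => f x + t%:C * g x)).
  rewrite sqr_L2normD//; last exact: in_L2Z.
  rewrite innerZr// L2normZ// exprMn real_normK ?num_real//.
  by rewrite cReM cReJ cImJ /= oppr0 mul0r subr0 mulrA.
have := L2norm_ge0 f; have := L2norm_ge0 g.
have [g0|g0] := eqVneq (L2norm g) 0.
  move=> _ _; rewrite g0 mulr0 leNgt; apply/negP => r0.
  (* With [|g| = 0] the expression is affine in [t]; this value makes it [-|f|^2 - 2]. *)
  have := h (- (L2norm f ^+ 2 + 1) / Re (inner f g)).
  rewrite -mulrA mulrAC -mulrA.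
  rewrite divff ?gt_eqF// g0 expr0n/= mulr0.
  by have := sqr_ge0 (L2norm f); lra.
rewrite le_eqVlt eq_sym (negbTE g0)/= => gp f0.
(* The minimiser in the case of equality; it leaves [2 |f| / |g|] times the wanted difference. *)
have := h (- L2norm f / L2norm g).
set a := L2norm f; set b := L2norm g; set r := Re _.
have -> : a ^+ 2 + 2 * (- a / b) * r + (- a / b) ^+ 2 * b ^+ 2 =
   (2 * a / b) * (a * b - r) by field; rewrite gt_eqF.
have [a0|ap] := eqVneq a 0; last first.
  rewrite pmulr_rge0 ?subr_ge0// !mulr_gt0 ?invr_gt0// lt_neqAle eq_sym ap.
  exact: L2norm_ge0.
(* For [|f| = 0] the previous choice says nothing; the minimiser of the quadratic leaves
   [- r^2 / |g|^2], so [r = 0]. *)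
move=> _; have := h (- r / b ^+ 2); rewrite -/a -/b -/r a0 mul0r.
have -> : 0 ^+ 2 + 2 * (- r / b ^+ 2) * r + (- r / b ^+ 2) ^+ 2 * b ^+ 2 =
   - (r ^+ 2 / b ^+ 2) by field; rewrite gt_eqF.
rewrite oppr_ge0 pmulr_lle0 ?invr_gt0 ?exprn_gt0// => r0.
rewrite -[leLHS]/r; suff -> : r = 0 by [].
by apply/eqP; rewrite -sqrf_eq0 eq_le r0 sqr_ge0.
Qed.

(** Multiplying [g] by the number [z = (f, g)] turns the real part into [|z|^2], so the bound on
    real parts applies. *)
Lemma normc_inner_le f g : in_L2 f -> in_L2 g ->
  normc (inner f g) <= L2norm f * L2norm g.
Proof.
move=> hf hg; set z := inner f g.
have [->|z0] := eqVneq (normc z) 0; first by rewrite mulr_ge0 ?L2norm_ge0.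
have zp : 0 < normc z by rewrite lt_neqAle eq_sym z0 normc_ge0.
have hZ : in_L2 (fun x => z * g x) by exact: in_L2Z.
have h : L2norm (fun x => z * g x) = normc z * L2norm g.
  apply: (@pexpIrn _ 2) => //; rewrite ?nnegrE ?mulr_ge0 ?L2norm_ge0 ?normc_ge0//.
  rewrite exprMn sqr_normcE [LHS]sqr_L2normE// innerZl ?innerZr//.
  rewrite inner_diag// !(cReM, cImM) cReJ cImJ /=; ring.
have := Re_inner_le hf hZ; rewrite innerZr// h -/z.
rewrite cReM cReJ cImJ mulNr opprK -!expr2 -sqr_normcE expr2 mulrCA.
by rewrite ler_pM2l.
Qed.

Lemma normr_Re_inner_le f g : in_L2 f -> in_L2 g ->
  `|Re (inner f g)| <= L2norm f * L2norm g.
Proof.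
by move=> hf hg; exact: le_trans (normr_Re_le_normc _) (normc_inner_le hf hg).
Qed.

Lemma L2normD_le f g : in_L2 f -> in_L2 g ->
  L2norm (fun x => f x + g x) <= L2norm f + L2norm g.
Proof.
move=> hf hg; rewrite -(@ler_pXn2r _ 2) ?nnegrE ?addr_ge0 ?L2norm_ge0//.
by rewrite sqr_L2normD//; have := Re_inner_le hf hg; nra.
Qed.

Definition ae_eqL2 f g := \forall x \ae mu, Omega x -> f x = g x.

Lemma ae_eq_cintegral f g :
  measurable_fun Omega (fun x => Re (f x)) ->
  measurable_fun Omega (fun x => Im (f x)) ->
  measurable_fun Omega (fun x => Re (g x)) ->
  measurable_fun Omega (fun x => Im (g x)) ->
  ae_eqL2 f g -> cintegral Omega f = cintegral Omega g.
Proof.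
move=> rf jf rg jg fg; apply: complex_ext => /=; congr fine;
  apply: ae_eq_integral => //; do ?exact/measurable_EFinP.
- by apply: filterS fg => x fg Ox; rewrite (fg Ox).
- by apply: filterS fg => x fg Ox; rewrite (fg Ox).
Qed.

Lemma ae_eq_cintegralM f g v : in_L2 f -> in_L2 g -> in_L2 v -> ae_eqL2 f g ->
  cintegral Omega (fun x => f x * v x) = cintegral Omega (fun x => g x * v x).
Proof.
move=> hf hg hv fg.
have [/measurable_int/measurable_EFinP ? /measurable_int/measurable_EFinP ?] :=
  cintegrableM hf hv.
have [/measurable_int/measurable_EFinP ? /measurable_int/measurable_EFinP ?] :=
  cintegrableM hg hv.
apply: ae_eq_cintegral => //.
by apply: filterS fg => x fg Ox; rewrite (fg Ox).
Qed.

Lemma ae_eq_innerl f g v : in_L2 f -> in_L2 g -> in_L2 v -> ae_eqL2 f g ->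
  inner f v = inner g v.
Proof. by move=> hf hg /in_L2J hv; exact: ae_eq_cintegralM. Qed.

Lemma ae_eq_innerr f g v : in_L2 f -> in_L2 g -> in_L2 v -> ae_eqL2 f g ->
  inner v f = inner v g.
Proof. by move=> hf hg hv fg; rewrite innerC// (ae_eq_innerl hf hg)// -innerC. Qed.

Lemma ae_eq_L2norm f g : in_L2 f -> in_L2 g -> ae_eqL2 f g -> L2norm f = L2norm g.
Proof.
move=> hf hg fg; apply: (@pexpIrn _ 2) => //; rewrite ?nnegrE ?L2norm_ge0//.
by rewrite !sqr_L2normE// (ae_eq_innerl hf hg)// (ae_eq_innerr hf hg).
Qed.

Lemma L2norm_eq0 f : in_L2 f -> L2norm f = 0 -> ae_eqL2 f (fun=> 0).
Proof.
move=> hf f0; have [ir ii] := cintegrableM hf (in_L2J hf).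
have : (\int[mu]_(x in Omega) `|(normc (f x) ^+ 2)%:E| = 0)%E.
  have e : {in Omega, EFin \o (fun x => Re (f x * (f x)^*)) =1
       (fun x => `|(normc (f x) ^+ 2)%:E|%E)}.
    move=> x _ /=; rewrite ger0_norm ?sqr_ge0// sqr_normcE cReM cReJ cImJ.
    by congr EFin; ring.
  rewrite -(eq_integral _ _ e) -[LHS]fineK ?integrable_fin_num//.
  by rewrite -[fine _]/(Re (inner f f)) -sqr_L2normE// f0 expr0n.
have mf : measurable_fun Omega (EFin \o (fun x => normc (f x) ^+ 2)).
  case: hf => mr mi _; apply/measurable_EFinP.
  under eq_fun do rewrite sqr_normcE.
  by apply: measurable_funD; exact: measurable_funX.
move=> /(ae_eq_integral_abs mu mO mf) /=.
apply: filterS => x /[apply] -[] /eqP; rewrite sqrf_eq0 => /eqP.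
exact: eq0_normc.
Qed.

End L2_theory.

(** * Integrals of partial derivatives *)

Section partial_derivatives.
Variable R : realType.
Local Notation mu := (lebesgue_rV R).

Lemma continuous_measurable_rV n (g : 'rV[R]_n -> R) :
  continuous g -> measurable_fun setT g.
Proof.
move=> /continuousP cg.
apply: (measurability _ (RGenOpens.measurableE R)) => _ [_ [a [b ->] <-]].
by rewrite setTI; apply: open_measurable_rV; apply: cg; exact: interval_open.
Qed.

(** The two difference quotients are the same function of [h]. This identifies a partial derivative
    in dimension n+1 with a derivative of a slice. *)
Lemma derive_transfer (V V' : normedModType R) (F : V -> R) (G : V' -> R) x v y w :
  (forall h : R, F (h *: v + x) = G (h *: w + y)) ->
  (derivable F x v <-> derivable G y w) /\ 'D_v F x = 'D_w G y.
Proof.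
move=> FG; have FGx : F x = G y by have := FG 0; rewrite !scale0r !add0r.
have e : (fun h : R => h^-1 *: ((F \o shift x) (h *: v) - F x)) =
    (fun h => h^-1 *: ((G \o shift y) (h *: w) - G y)).
  by apply/funext => h /=; rewrite FG FGx.
by rewrite /derivable /derive e.
Qed.

Lemma rVcons_shift n (a h : R) (y : 'rV[R]_n) (j : 'I_n) :
  rVcons (a, h *: delta_mx ord0 j + y) =
  h *: delta_mx ord0 (lift ord0 j) + rVcons (a, y).
Proof.
apply/rowP => i; rewrite !mxE !eqxx/=.
by case: (unliftP ord0 i) => [i'|] ->;
  rewrite ?liftK ?unlift_none/= ?mxE ?eqxx//= mulr0 add0r.
Qed.

Lemma rVcons_shift0 n (a h : R) (y : 'rV[R]_n) :
  rVcons (h *: 1 + a, y) = h *: delta_mx ord0 ord0 + rVcons (a, y).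
Proof.
apply/rowP => i; rewrite !mxE !eqxx/=.
by case: (unliftP ord0 i) => [i'|] ->; rewrite ?liftK ?unlift_none//= mulr0 add0r.
Qed.

Lemma continuous_rVconsl n (y : 'rV[R]_n) : continuous (fun a : R => rVcons (a, y)).
Proof.
move=> a B /nbhs_ballP[e /= e0 eB]; apply/nbhs_ballP; exists e => //= b ab.
apply: eB; split=> // i j; rewrite !mxE; case: unlift => //=.
by move=> k; exact: ballxx.
Qed.

Lemma continuous_rVconsr n (a : R) : continuous (fun y : 'rV[R]_n => rVcons (a, y)).
Proof.
move=> y B /nbhs_ballP[e /= e0 eB]; apply/nbhs_ballP; exists e => //= z [_ yz].
apply: eB; split=> // i j; rewrite !mxE; case: unlift => /=; last exact: ballxx.
by move=> k; exact: yz.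
Qed.

(** One large coordinate suffices, so the condition passes from a point of a slice to the full
    point. *)
Definition outside n (M : R) (x : 'rV[R]_n) := exists i, M < `|x ord0 i|.

Lemma derive_outside n (g : 'rV[R]_n -> R) (M : R) j x :
  (forall x, outside M x -> g x = 0) -> outside M x ->
  'D_(delta_mx ord0 j) g x = 0.
Proof.
move=> gM [i Mx].
rewrite -[RHS](derive_cst 0 x (delta_mx ord0 j : 'rV[R]_n)).
apply: near_eq_derive.
have : nbhs x (fun y : 'rV[R]_n => M < `|y ord0 i|).
  exact: (cvgr_norm_gt (x ord0 i) (@coord_continuous R 1 n ord0 i x) M Mx).
by apply: filterS => y My; rewrite gM//; exists i.
Qed.

Definition cube n (M : R) : set 'rV[R]_n :=
  [set x | forall i, `[- M, M]%classic (x ord0 i)].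

Lemma compact_cube n (M : R) : compact (@cube n M).
Proof.
by apply: (@rV_compact _ _ (fun=> `[- M, M]%classic)) => _; exact: segment_compact.
Qed.

Lemma not_outside n (M : R) (x : 'rV[R]_n) : ~ outside M x -> @cube n M x.
Proof.
move=> h i; rewrite /= in_itv/= -ler_norml leNgt; apply/negP => Mi.
by apply: h; exists i.
Qed.

Lemma measurable_cube n (M : R) : measurable (@cube n M).
Proof.
by apply: (@measurable_rVbox R n (fun=> `[- M, M]%classic)) => i; exact: measurable_itv.
Qed.

Lemma cube_lty n (M : R) : (mu n (@cube n M) < +oo)%E.
Proof.
rewrite (@lebesgue_rV_box R n (fun=> `[- M, M]%classic)); last first.
  by move=> i; exact: measurable_itv.
suff /andP[] : (0 <= \prod_(i < n) lebesgue_measure `[(- M)%R, M]%classic < +oo)%E.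
  by [].
elim/big_ind : _ => [|x y /andP[x0 xoo] /andP[y0 yoo]|i _].
- by rewrite lee_fin ler01 ltry.
- by rewrite mule_ge0//= lte_mul_pinfty// ge0_fin_numE.
- rewrite measure_ge0/= lebesgue_measure_itv/=.
  by case: ifP => _; rewrite ?ltry// -EFinD ltry.
Qed.

Lemma integrable_outside n (f : 'rV[R]_n -> R) (M : R) :
  continuous f -> (forall x, outside M x -> f x = 0) ->
  (mu n).-integrable setT (EFin \o f).
Proof.
move=> cf fM.
have -> : EFin \o f = (EFin \o f) \_ (@cube n M).
  apply/funext => x; rewrite patchE; case: ifPn => // /negP xQ /=.
  rewrite fM//; apply: contrapT => /not_outside h; apply: xQ.
  by rewrite inE.
apply/(integrable_mkcond _ (@measurable_cube n M)).
apply: measurable_bounded_integrable.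
- exact: measurable_cube.
- exact: cube_lty.
- exact: measurable_funTS (continuous_measurable_rV cf).
- have /compact_bounded[B [Br Bf]] : compact (f @` @cube n M).
    apply: continuous_compact; last exact: compact_cube.
    exact: continuous_subspaceT.
  exists B; split=> // C BC x Qx; apply: (Bf C BC); by exists x.
Qed.

Lemma integral_derive_line (g : R -> R) (M : R) :
  (forall x, derivable g x 1) -> continuous ('D_1 g) ->
  (forall x, M < `|x| -> g x = 0) ->
  (\int[lebesgue_measure]_x ('D_1 g x)%:E = 0)%E.
Proof.
(* [M] may be negative; [L] exceeds both 0 and [M], so the interval is nondegenerate and [g]
   vanishes at its ends. *)
move=> dg cg gM; pose L := `|M| + 1.
have L0 : 0 < L by rewrite /L ltr_wpDl.
have ML : M < L by rewrite /L (le_lt_trans (ler_norm M))// ltrDl.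
have Dg x : M < `|x| -> 'D_1 g x = 0.
  move=> Mx; rewrite -[RHS](derive_cst 0 x 1); apply: near_eq_derive.
  have : nbhs x (fun y : R => M < `|y|).
    exact: (cvgr_norm_gt x cvg_id).
  by apply: filterS => y My; rewrite gM.
have -> : (fun x => ('D_1 g x)%:E) = (fun x => ('D_1 g x)%:E) \_ `[- L, L].
  apply/funext => x; rewrite patchE; case: ifPn => // /negP xL.
  rewrite Dg// (lt_trans ML)// ltNge; apply/negP => xl; apply: xL.
  by rewrite inE /= in_itv/= -ler_norml.
rewrite -integral_mkcond.
have cg' x : {for x, continuous g}.
  exact/differentiable_continuous/derivable1_diffP.
rewrite (@continuous_FTC2 _ _ g).
- by rewrite -EFinB !gM ?normrN ?gtr0_norm// subrr.
- by rewrite -subr_gt0 opprK addr_gt0.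
- exact: continuous_subspaceT.
- split=> //.
  + exact/cvg_at_right_filter/cg'.
  + exact/cvg_at_left_filter/cg'.
- by move=> x _; rewrite derive1E.
Qed.

(** Induction along the recursive construction of [lebesgue_rV]. Fubini is used in the order that
    first integrates the block containing the differentiated variable, so that the inner integral
    already vanishes. *)
Lemma integral_partial_eq0 n (j : 'I_n) (g : 'rV[R]_n -> R) (M : R) :
  (forall x, derivable g x (delta_mx ord0 j)) ->
  continuous (partial j g) -> (forall x, outside M x -> g x = 0) ->
  (\int[mu n]_x (partial j g x)%:E = 0)%E.
Proof.
elim: n => [|n IH] in j g *; first by case: j.
move=> dg cg gM.
have Dg x : outside M x -> partial j g x = 0 by exact: derive_outside.
have ig := integrable_outside cg Dg.
have mg' : measurable_fun setT (partial j g) by exact: continuous_measurable_rV.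
have mg : measurable_fun setT (EFin \o partial j g) by exact/measurable_EFinP.
pose F := (EFin \o partial j g) \o @rVcons R n.
have iF : (lebesgue_measure \x mu n)%E.-integrable setT F.
  move/integrableP : ig => [_ h]; apply/integrableP; split.
    exact: measurableT_comp mg (@measurable_rVcons R n).
  move: h; rewrite /= /cons_measure ge0_integral_pushforward//=.
  - exact: measurable_rVcons.
  - by apply/measurable_EFinP; exact: measurableT_comp.
transitivity (\int[lebesgue_measure \x mu n]_p F p)%E.
  rewrite /= /cons_measure integral_pushforward//.
  exact: measurable_rVcons.
case: (unliftP ord0 j) => [k|] jE.
(* Differentiation in the tail: with the head [a] frozen, the slice falls under the induction
   hypothesis. *)
- rewrite -integral12_prod_meas1//; apply: integral0_eq => a _.
  rewrite /fubini_F.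
  pose G y := g (rVcons (a, y)).
  have GE y : (derivable G y (delta_mx ord0 k) <->
      derivable g (rVcons (a, y)) (delta_mx ord0 j)) /\
      partial k G y = partial j g (rVcons (a, y)).
    by apply: derive_transfer => h; rewrite /G rVcons_shift jE.
  rewrite -[RHS](IH k G).
  + by apply: eq_integral => y _; rewrite /F /= (GE y).2.
  + by move=> y; apply/(GE y).1.
  + rewrite (_ : partial k G = partial j g \o (fun y => rVcons (a, y))).
      move=> y; apply: continuous_comp; first exact: continuous_rVconsr.
      exact: cg.
    by apply/funext => y; rewrite (GE y).2.
  + move=> y [i Mi]; apply: gM; exists (lift ord0 i).
    by rewrite mxE liftK.
(* Differentiation in the head: the slice is a function on the line. *)
- rewrite -integral21_prod_meas1//; apply: integral0_eq => y _.
  rewrite /fubini_G.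
  pose G (a : R) := g (rVcons (a, y)).
  have GE a : (derivable G a 1 <->
      derivable g (rVcons (a, y)) (delta_mx ord0 j)) /\
      'D_1 G a = partial j g (rVcons (a, y)).
    by apply: derive_transfer => h; rewrite /G rVcons_shift0 jE.
  rewrite -[RHS](@integral_derive_line G M).
  + by apply: eq_integral => a _; rewrite /F /= (GE a).2.
  + by move=> a; apply/(GE a).1.
  + rewrite (_ : 'D_1 G = partial j g \o (fun a : R => rVcons (a, y))).
      move=> a; apply: continuous_comp; first exact: continuous_rVconsl.
      exact: cg.
    by apply/funext => a; rewrite (GE a).2.
  + move=> a Ma; apply: gM; exists ord0.
    by rewrite mxE unlift_none.
Qed.

End partial_derivatives.

(** * Test functions and their classical derivatives *)

Section test_functions.
Variables (R : realType) (n : nat) (Omega : set 'rV[R]_n).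
Hypothesis mO : measurable Omega.
Local Open Scope complex_scope.
Local Notation mu := (lebesgue_rV R n).
Local Notation inner := (inner Omega).
Local Notation L2norm := (L2norm Omega).
Local Notation in_L2 := (in_L2 Omega).
Local Notation Re := (@complex.Re R).
Local Notation Im := (@complex.Im R).
Local Notation test_fun := (test_fun Omega).
Implicit Types (phi psi theta : 'rV[R]_n -> R) (f g v w : 'rV[R]_n -> R[i]).

Lemma test_fun_continuous phi : test_fun phi -> continuous phi.
Proof. by move=> [/(_ [::])[]]. Qed.

Lemma test_fun_derivable phi j x :
  test_fun phi -> derivable phi x (delta_mx ord0 j).
Proof. by move=> [/(_ [::])[_]]; exact. Qed.

Lemma test_fun_partial phi j : test_fun phi -> test_fun (partial j phi).
Proof.
move=> [sphi [K [cK KO Kphi]]]; split.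
  (* [foldr] applies the last index of the list first. *)
  by move=> s; have := sphi (rcons s j); rewrite /partials foldr_rcons.
exists K; split=> // x Kx; rewrite /partial.
rewrite -[RHS](derive_cst 0 x (delta_mx ord0 j : 'rV[R]_n)).
apply: near_eq_derive.
have oK : open (~` K).
  by rewrite openC; apply: compact_closed => //; exact: norm_hausdorff.
have : nbhs x (~` K) by exact: open_nbhs_nbhs.
by apply: filterS => y Ky; rewrite Kphi.
Qed.

Lemma test_fun_notin phi x : test_fun phi -> ~ Omega x -> phi x = 0.
Proof. by move=> [_ [K [_ KO Kphi]]] Ox; apply: Kphi => Kx; exact/Ox/KO. Qed.

Lemma ler_coord_norm (x : 'rV[R]_n) i : `|x ord0 i| <= `|x|.
Proof.
rewrite [leRHS]/Num.norm/= mx_normrE.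
by rewrite (le_bigmax _ (fun ij => `|x ij.1 ij.2|) (ord0, i)).
Qed.

Lemma test_fun_outside phi :
  test_fun phi -> exists M, forall x, outside M x -> phi x = 0.
Proof.
move=> [_ [K [/compact_bounded[M [_ KM]] KO Kphi]]].
exists (M + 1) => x [i Mx]; apply: Kphi => Kx.
have := KM (M + 1) _ x Kx; rewrite ltrDl ltr01 => /(_ isT).
by move=> /(le_trans (ler_coord_norm x i)); rewrite leNgt Mx.
Qed.

(** By the product rule the two integrals add up to that of a partial derivative of [phi * theta];
    both factors vanish outside [Omega], so it equals the integral over the whole space, which is
    0. *)
Lemma test_funM_integral phi theta j : test_fun phi -> test_fun theta ->
  \int[mu]_(x in Omega) (phi x * partial j theta x) =
  - \int[mu]_(x in Omega) (partial j phi x * theta x).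
Proof.
move=> hp ht; have hdp := test_fun_partial j hp; have hdt := test_fun_partial j ht.
have [M pM] := test_fun_outside hp.
have cp := test_fun_continuous hp; have ct := test_fun_continuous ht.
have cdp := test_fun_continuous hdp; have cdt := test_fun_continuous hdt.
have dE x : partial j (phi * theta) x =
    phi x * partial j theta x + partial j phi x * theta x.
  rewrite /partial deriveM; [|exact: test_fun_derivable..].
  by rewrite [theta x *: _]mulrC.
have c1 : continuous (fun x => phi x * partial j theta x).
  by move=> x; exact: (cvgM (cp x) (cdt x)).
have c2 : continuous (fun x => partial j phi x * theta x).
  by move=> x; exact: (cvgM (cdp x) (ct x)).
have int (g : 'rV[R]_n -> R) : continuous g -> (forall x, outside M x -> g x = 0) ->
    mu.-integrable Omega (EFin \o g).
  move=> cg gM; apply: (@integrableS _ _ _ _ setT) => //.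
  exact: integrable_outside cg gM.
have i1 := int _ c1 (fun x xM => etrans (congr1 (fun z => z * _) (pM x xM)) (mul0r _)).
have i2 := int _ c2 (fun x xM => etrans
  (congr1 (fun z => z * _) (derive_outside j pM xM)) (mul0r _)).
apply/eqP; rewrite -addr_eq0 -RintegralD//; apply/eqP.
have h := @integral_partial_eq0 R n j (phi * theta) M.
rewrite /Rintegral integral_mkcond.
suff -> : (fun x => (phi x * partial j theta x + partial j phi x * theta x)%:E)
    \_ Omega = (fun x => (partial j (phi * theta) x)%:E).
  rewrite h//.
  - by move=> x; apply: derivableM; exact: test_fun_derivable.
  - rewrite (_ : partial j _ = fun x => phi x * partial j theta x
        + partial j phi x * theta x); last exact/funext.
    by move=> x; exact: (cvgD (c1 x) (c2 x)).
  - move=> x xM.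
    exact: (etrans (congr1 (fun z => z * theta x) (pM x xM)) (mul0r _)).
apply/funext => x; rewrite patchE dE; case: ifPn => // /negP Ox.
have nx : ~ Omega x by move=> ?; apply: Ox; rewrite inE.
by rewrite (test_fun_notin hp)// (test_fun_notin ht)// mulr0 mul0r addr0.
Qed.

Lemma in_L2_test phi psi : test_fun phi -> test_fun psi ->
  in_L2 (fun x => phi x +i* psi x).
Proof.
have h theta : test_fun theta -> sq_integrable mu Omega theta.
  move=> ht; have ct := test_fun_continuous ht; split.
    exact: measurable_funTS (continuous_measurable_rV ct).
  apply: (@integrableS _ _ _ _ setT) => //.
  have [M tM] := test_fun_outside ht.
  apply: (@integrable_outside _ _ _ M).
    by move=> x; exact: (cvgM (ct x) (ct x)).
  by move=> x xM; rewrite tM// expr0n.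
by move=> /h hp /h hq; apply/in_L2E => //; split.
Qed.

Lemma test_fun0 : test_fun (fun=> 0).
Proof.
have e (s : seq 'I_n) : partials s (fun=> 0 : R) = (fun=> 0).
  elim: s => //= i s ->.
  by apply/funext => x; rewrite /partial derive_cst.
split.
  move=> s; rewrite e; split; first exact: cst_continuous.
  by move=> x j; exact: derivable_cst.
by exists set0; split=> //; exact: compact0.
Qed.

Lemma in_L2_test1 phi : test_fun phi -> in_L2 (fun x => (phi x)%:C).
Proof. by move=> hp; exact: in_L2_test hp test_fun0. Qed.

Lemma weak_partial_test phi psi j : test_fun phi -> test_fun psi ->
  weak_partial Omega j (fun x => phi x +i* psi x)
    (fun x => partial j phi x +i* partial j psi x).
Proof.
move=> hp hq theta ht; apply: complex_ext.
- transitivity (\int[mu]_(x in Omega) (phi x * partial j theta x)).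
    by apply: eq_Rintegral => x _; rewrite /= mulr0 subr0.
  rewrite test_funM_integral// cReN; congr (- _).
  by apply: eq_Rintegral => x _; rewrite /= mulr0 subr0.
- transitivity (\int[mu]_(x in Omega) (psi x * partial j theta x)).
    by apply: eq_Rintegral => x _; rewrite /= mulr0 add0r.
  rewrite test_funM_integral// cImN; congr (- _).
  by apply: eq_Rintegral => x _; rewrite /= mulr0 add0r.
Qed.

Lemma in_H1_test phi psi : test_fun phi -> test_fun psi ->
  in_H1 Omega (fun x => phi x +i* psi x).
Proof.
move=> hp hq; split; first exact: in_L2_test.
move=> j; exists (fun x => partial j phi x +i* partial j psi x); split.
  by apply: in_L2_test; exact: test_fun_partial.
exact: weak_partial_test.
Qed.

End test_functions.

(** * Weak derivatives *)

Section weak_derivatives.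
Variables (R : realType) (n : nat) (Omega : set 'rV[R]_n).
Hypothesis mO : measurable Omega.
Local Open Scope complex_scope.
Local Notation mu := (lebesgue_rV R n).
Local Notation inner := (inner Omega).
Local Notation L2norm := (L2norm Omega).
Local Notation in_L2 := (in_L2 Omega).
Local Notation in_H1 := (in_H1 Omega).
Local Notation in_H10 := (in_H10 Omega).
Local Notation Re := (@complex.Re R).
Local Notation Im := (@complex.Im R).
Local Notation test_fun := (test_fun Omega).
Local Notation weak_partial := (weak_partial Omega).
Local Notation wpartial := (wpartial Omega).
Local Notation ae_eqL2 := (ae_eqL2 Omega).
Implicit Types (phi psi theta : 'rV[R]_n -> R) (f g v w : 'rV[R]_n -> R[i]).

Lemma L2norm_le_H1norm f : L2norm f <= H1norm Omega f.
Proof.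
rewrite -[leLHS]ger0_norm ?L2norm_ge0// -sqrtr_sqr ler_wsqrtr// lerDl.
exact: sqr_ge0.
Qed.

Lemma sqr_grad_normE f :
  grad_norm Omega f ^+ 2 = \sum_j L2norm (wpartial j f) ^+ 2.
Proof. by rewrite sqr_sqrtr// sumr_ge0// => j _; exact: sqr_ge0. Qed.

Lemma L2norm_wpartial_le_H1norm j f : L2norm (wpartial j f) <= H1norm Omega f.
Proof.
rewrite -[leLHS]ger0_norm ?L2norm_ge0// -sqrtr_sqr ler_wsqrtr//.
rewrite sqr_grad_normE.
rewrite ler_wpDl ?sqr_ge0// (bigD1 j)//= lerDl.
by apply: sumr_ge0 => i _; exact: sqr_ge0.
Qed.

(** Isolated as a property because uniqueness of weak derivatives, and all that follows from it,
    needs exactly this. *)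
Definition L2_separating := forall f, in_L2 f ->
  (forall phi, test_fun phi -> cintegral Omega (fun x => f x * (phi x)%:C) = 0) ->
  ae_eqL2 f (fun=> 0).

(** Weak derivatives are tested with real functions, [inner] with complex ones; the minus sign comes
    from the conjugation. *)
Lemma inner_test0 f phi psi : in_L2 f -> test_fun phi -> test_fun psi ->
  inner f (fun x => phi x +i* psi x) =
  cintegral Omega (fun x => f x * (phi x)%:C) -
  'i * cintegral Omega (fun x => f x * (psi x)%:C).
Proof.
move=> hf hp hq.
have Lp := in_L2_test1 mO hp; have Lq := in_L2_test1 mO hq.
have Lp' := cintegrableM mO hf Lp.
have Lq' := cintegrableM mO (in_L2Z mO (- 'i) hf) Lq.
rewrite -mulNr -cintegralZ//; last exact: cintegrableM.
rewrite -cintegralD//; last first.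
  by move: Lq'; under eq_fun do rewrite -mulrA.
congr cintegral; apply/funext => x; case: (f x) => a b.
by apply: complex_ext; rewrite !(cReD,cImD,cReM,cImM,cReN) /=; ring.
Qed.

(* The eigenfunctions form a basis and are limits of test functions, so test
   functions separate L^2; no mollification is needed. *)
Lemma eigenbasis_separating ev e :
  dirichlet_eigenbasis Omega ev e -> L2_separating.
Proof.
move=> [[hL _ he] hk _ _ _] f hf fphi.
have f0 k : inner f (e k) = 0.
  apply: eq0_normc; apply/eqP; rewrite eq_le normc_ge0 andbT.
  apply/ler_addgt0Pr => eps eps0; rewrite add0r.
  have [[_ he1] _] := hk k.
  have d0 : 0 < eps / (L2norm f + 1) by rewrite divr_gt0// ltr_wpDl ?L2norm_ge0.
  have [phi [psi [hp hq hd]]] := he1 _ d0.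
  have Lt := in_L2_test mO hp hq.
  have -> : inner f (e k) = inner f (fun x => e k x - (phi x +i* psi x)).
    by rewrite innerBr// inner_test0// !fphi// mulr0 !subr0.
  apply: (le_trans (normc_inner_le mO hf (in_L2B mO (hL k) Lt))).
  have := le_lt_trans (L2norm_le_H1norm _) hd.
  rewrite ltr_pdivlMr ?ltr_wpDl ?L2norm_ge0// => /ltW; apply: le_trans.
  by rewrite mulrC ler_wpM2l ?L2norm_ge0// lerDl.
apply: L2norm_eq0 => //.
have e0 m : L2norm (fun x => f x - \sum_(k < m) inner f (e k) * e k x) = L2norm f.
  congr Defs.L2norm; apply/funext => x.
  by rewrite big1 ?subr0// => i _; rewrite f0 mul0r.
have := he f hf; rewrite (_ : (fun m => _) = cst (L2norm f)); last exact/funext.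
by move=> /cvg_lim <- //; rewrite lim_cst.
Qed.

Hypothesis sep : L2_separating.

Lemma wpartialP j f : in_H1 f ->
  in_L2 (wpartial j f) /\ weak_partial j f (wpartial j f).
Proof.
move=> [_ /(_ j)[g hg]]; rewrite /wpartial.
by case: xgetP => [h _ //|/(_ g)]; case.
Qed.

Lemma in_L2_wpartial j f : in_H1 f -> in_L2 (wpartial j f).
Proof. by move=> /(wpartialP j)[]. Qed.

(** [wpartial] picks an arbitrary representative, so each algebraic rule for it is obtained by
    exhibiting a weak derivative and comparing almost everywhere. *)
Lemma weak_partial_unique j f g : in_H1 f -> in_L2 g -> weak_partial j f g ->
  ae_eqL2 (wpartial j f) g.
Proof.
move=> hf hg wg; have [hw ww] := wpartialP j hf.
have hwg : in_L2 (fun x => wpartial j f x - g x) by exact: in_L2B.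
have := sep hwg _; move=> h.
have {}h : ae_eqL2 (fun x => wpartial j f x - g x) (fun=> 0).
  apply: h => phi hp; have hp1 := in_L2_test1 mO hp.
  transitivity (cintegral Omega (fun x => wpartial j f x * (phi x)%:C) -
      cintegral Omega (fun x => g x * (phi x)%:C)).
    rewrite -mulN1r -cintegralZ//; last exact: cintegrableM.
    rewrite -cintegralD//; last 2 first.
    - exact: cintegrableM.
    - have := cintegrableM mO (in_L2Z mO (-1) hg) hp1.
      by under eq_fun do rewrite -mulrA.
    by congr cintegral; apply/funext => x; rewrite mulrBl mulN1r.
  by move: (ww _ hp); rewrite (wg _ hp) => /oppr_inj ->; exact: subrr.
by apply: filterS h => x h Ox; apply/eqP; rewrite -subr_eq0; exact/eqP/h.
Qed.

Lemma weak_partialD j f g f' g' : in_L2 f -> in_L2 g -> in_L2 f' -> in_L2 g' ->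
  weak_partial j f f' -> weak_partial j g g' ->
  weak_partial j (fun x => f x + g x) (fun x => f' x + g' x).
Proof.
move=> hf hg hf' hg' wf wg phi hp.
have hp1 := in_L2_test1 mO hp; have hdp := in_L2_test1 mO (test_fun_partial j hp).
under eq_fun do rewrite mulrDl.
rewrite cintegralD//; do ?exact: cintegrableM.
under [in RHS]eq_fun do rewrite mulrDl.
rewrite cintegralD//; do ?exact: cintegrableM.
by rewrite wf// wg// opprD.
Qed.

Lemma weak_partialZ j c f f' : in_L2 f -> in_L2 f' ->
  weak_partial j f f' -> weak_partial j (fun x => c * f x) (fun x => c * f' x).
Proof.
move=> hf hf' wf phi hp.
have hp1 := in_L2_test1 mO hp; have hdp := in_L2_test1 mO (test_fun_partial j hp).
under eq_fun do rewrite -mulrA.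
rewrite cintegralZ//; do ?exact: cintegrableM.
under [in RHS]eq_fun do rewrite -mulrA.
rewrite cintegralZ//; do ?exact: cintegrableM.
by rewrite wf// mulrN.
Qed.

Lemma in_H1D f g : in_H1 f -> in_H1 g -> in_H1 (fun x => f x + g x).
Proof.
move=> hf hg; split; first exact: in_L2D hf.1 hg.1.
move=> j; have [? ?] := wpartialP j hf; have [? ?] := wpartialP j hg.
exists (fun x => wpartial j f x + wpartial j g x); split; first exact: in_L2D.
by apply: weak_partialD => //; [exact: hf.1|exact: hg.1].
Qed.

Lemma in_H1Z c f : in_H1 f -> in_H1 (fun x => c * f x).
Proof.
move=> hf; split; first exact: in_L2Z hf.1.
move=> j; have [? ?] := wpartialP j hf.
exists (fun x => c * wpartial j f x); split; first exact: in_L2Z.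
by apply: weak_partialZ => //; exact: hf.1.
Qed.

Lemma wpartialD j f g : in_H1 f -> in_H1 g ->
  ae_eqL2 (wpartial j (fun x => f x + g x))
    (fun x => wpartial j f x + wpartial j g x).
Proof.
move=> hf hg; have [? ?] := wpartialP j hf; have [? ?] := wpartialP j hg.
apply: weak_partial_unique; [exact: in_H1D|exact: in_L2D|].
by apply: weak_partialD => //; [exact: hf.1|exact: hg.1].
Qed.

Lemma wpartialZ j c f : in_H1 f ->
  ae_eqL2 (wpartial j (fun x => c * f x)) (fun x => c * wpartial j f x).
Proof.
move=> hf; have [? ?] := wpartialP j hf.
apply: weak_partial_unique; [exact: in_H1Z|exact: in_L2Z|].
by apply: weak_partialZ => //; exact: hf.1.
Qed.

Lemma in_H1B f g : in_H1 f -> in_H1 g -> in_H1 (fun x => f x - g x).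
Proof.
move=> hf hg; have := in_H1D hf (in_H1Z (-1) hg).
by under eq_fun do rewrite mulN1r.
Qed.

Lemma wpartialB j f g : in_H1 f -> in_H1 g ->
  ae_eqL2 (wpartial j (fun x => f x - g x))
    (fun x => wpartial j f x - wpartial j g x).
Proof.
move=> hf hg; have hg' := in_H1Z (-1) hg.
have e : (fun x => f x - g x) = (fun x => f x + (-1) * g x).
  by apply/funext => x; rewrite mulN1r.
rewrite e; apply: filterS2 (wpartialD j hf hg') (wpartialZ j (-1) hg).
by move=> x h1 h2 Ox; rewrite h1// h2// mulN1r.
Qed.

(** For test functions this is the definition of the weak derivative of [f]; both sides are
    continuous in [v] for the H^1 norm, which gives the closure. *)
Lemma integration_by_parts j f v : in_H1 f -> in_H10 v ->
  inner (wpartial j f) v = - inner f (wpartial j v).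
Proof.
move=> hf [hv hv0]; apply/eqP; rewrite -addr_eq0; apply/eqP.
have [hL hdf] := (hf.1, in_L2_wpartial j hf).
have hdv := in_L2_wpartial j hv.
apply: eq0_normc; apply/eqP; rewrite eq_le normc_ge0 andbT.
apply/ler_addgt0Pr => eps eps0; rewrite add0r.
(* [C] exceeds the factor by which the defect of the identity is bounded in terms of the H^1 norm;
   the [+ 1] makes it positive. *)
set C := L2norm f + L2norm (wpartial j f) + 1.
have C0 : 0 < C by rewrite ltr_wpDl// addr_ge0 ?L2norm_ge0.
have [phi [psi [hp hq hd]]] := hv0 _ (divr_gt0 eps0 C0).
set chi := fun x => phi x +i* psi x in hd.
have hchi : in_H1 chi by exact: in_H1_test.
have hdchi := in_L2_test mO (test_fun_partial j hp) (test_fun_partial j hq).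
have hw : in_H1 (fun x => v x - chi x) by exact: in_H1B.
have hdw := in_L2_wpartial j hw.
have wchi := weak_partial_unique hchi hdchi (weak_partial_test mO j hp hq).
have dw : ae_eqL2 (wpartial j (fun x => v x - chi x))
    (fun x => wpartial j v x - (partial j phi x +i* partial j psi x)).
  apply: filterS2 (wpartialB j hv hchi) wchi => x h1 h2 Ox.
  by rewrite h1// h2.
(* The defect vanishes on [chi], so [v] may be replaced by [v - chi]. *)
have -> : inner (wpartial j f) v + inner f (wpartial j v) =
    inner (wpartial j f) (fun x => v x - chi x) +
    inner f (wpartial j (fun x => v x - chi x)).
  rewrite (ae_eq_innerr mO hdw _ hL dw); last exact: in_L2B.
  rewrite (innerBr mO hv.1 hchi.1 hdf) (innerBr mO hdv hdchi hL).
  have [_ wf] := wpartialP j hf.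
  rewrite !inner_test0//; do ?exact: test_fun_partial.
  by rewrite !wf//; ring.
apply: le_trans (le_normcD _ _) _.
apply: le_trans (lerD (normc_inner_le mO hdf hw.1) (normc_inner_le mO hL hdw)) _.
have h1 := le_lt_trans (L2norm_le_H1norm _) hd.
have h2 := le_lt_trans (L2norm_wpartial_le_H1norm j _) hd.
apply: le_trans (lerD (ler_wpM2l (L2norm_ge0 _ _) (ltW h1))
  (ler_wpM2l (L2norm_ge0 _ _) (ltW h2))) _.
rewrite -mulrDl mulrCA ger_pMr// ler_pdivrMr// mul1r.
by rewrite /C addrC lerDl.
Qed.

Lemma in_L2_laplacian f : in_H2 Omega f -> in_L2 (laplacian Omega f).
Proof.
by move=> [hf hf2]; apply: in_L2_sum => // j; apply: in_L2_wpartial; exact: hf2.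
Qed.

Lemma green f v : in_H2 Omega f -> in_H10 v ->
  \sum_j inner (wpartial j f) (wpartial j v) = - inner (laplacian Omega f) v.
Proof.
move=> [hf hf2] hv; rewrite inner_suml//; last first.
- exact: hv.1.1.
- by move=> j; apply: in_L2_wpartial; exact: hf2.
rewrite -sumrN; apply: eq_bigr => j _.
by rewrite (integration_by_parts j (hf2 j) hv) opprK.
Qed.

Lemma sqr_grad_norm f : in_H1 f ->
  (grad_norm Omega f ^+ 2)%:C = \sum_j inner (wpartial j f) (wpartial j f).
Proof.
move=> hf; rewrite sqr_grad_normE rmorph_sum; apply: eq_bigr => j _.
by rewrite inner_diag//; exact: in_L2_wpartial.
Qed.

End weak_derivatives.

(** * Eigenfunction expansions *)

Section weighted_sums.
Variables (R : realType) (ev a : nat -> R) (A B : R).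
Hypotheses (ev0 : 0 < ev 0%N) (hev : {homo ev : k l / (k <= l)%N >-> k <= l}).
Hypotheses (a0 : forall k, 0 <= a k).
Hypothesis aA : \sum_(k < m) a k @[m --> \oo] --> A.
Hypothesis aB : forall m, \sum_(k < m) ev k * a k <= B.

Let ev_gt0 k : 0 < ev k.
Proof. by apply: lt_le_trans ev0 _; exact: hev. Qed.

(** Used with [a k = |u_k|^2] and with [a k = ev k * |u_k|^2], which gives the two Poincare
    inequalities. *)
Lemma first_weight_le : ev 0%N * A <= B.
Proof.
have h : ev 0%N * \sum_(k < m) a k @[m --> \oo] --> ev 0%N * A.
  exact: cvgMr.
rewrite -(cvg_lim _ h)//; apply: limr_le; first by apply/cvg_ex; exists (ev 0%N * A).
near=> m; apply: le_trans (aB m); rewrite mulr_sumr; apply: ler_sum => k _.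
by rewrite ler_wpM2r// hev.
Unshelve. all: by end_near. Qed.

(** Indices start at 0, so the uncontrolled tail begins at [N], and [ev N] is the smallest weight
    there by monotonicity. On the modes below [N] the factor [gamma - mu] is nonpositive. *)
Lemma weighted_tail_le (gamma mu : R) N : 0 < gamma -> gamma <= mu ->
  gamma * A - mu * \sum_(k < N) a k <= gamma * (ev N)^-1 * B.
Proof.
move=> g0 gmu; set S := \sum_(k < N) a k.
have h : gamma * \sum_(k < m) a k - mu * S @[m --> \oo] --> gamma * A - mu * S.
  by apply: cvgB; [exact: cvgMr|exact: cvg_cst].
rewrite -(cvg_lim _ h)//; apply: limr_le.
  by apply/cvg_ex; exists (gamma * A - mu * S).
near=> m; have Nm : (N <= m)%N by near: m; exact: nbhs_infty_ge.
have e (F : nat -> R) : \sum_(k < m) F k =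
    \sum_(k < N) F k + \sum_(N <= k < m) F k.
  by rewrite -!(big_mkord xpredT F) (@big_cat_nat _ _ _ N).
apply: (@le_trans _ _ (gamma * \sum_(N <= k < m) a k)).
  rewrite e -/S mulrDr addrAC gerDr subr_le0 ler_wpM2r//.
  by apply: sumr_ge0.
rewrite -mulrA ler_pM2l// ler_pdivlMl// (le_trans _ (aB m))//.
rewrite (e (fun k => ev k * a k)).
rewrite mulr_sumr ler_wpDl//.
  by apply: sumr_ge0 => k _; rewrite mulr_ge0// ltW.
rewrite !big_nat; apply: ler_sum => k /andP[Nk _].
by rewrite ler_wpM2r// hev.
Unshelve. all: by end_near. Qed.

End weighted_sums.

(** * Projections, Parseval's identity and spectral inequalities *)

Section eigenexpansion.
Variables (R : realType) (n : nat) (Omega : set 'rV[R]_n).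
Hypothesis mO : measurable Omega.
Local Open Scope complex_scope.
Local Notation mu := (lebesgue_rV R n).
Local Notation inner := (inner Omega).
Local Notation L2norm := (L2norm Omega).
Local Notation in_L2 := (in_L2 Omega).
Local Notation in_H10 := (in_H10 Omega).
Local Notation in_H2 := (in_H2 Omega).
Local Notation Re := (@complex.Re R).
Local Notation Im := (@complex.Im R).
Local Notation wpartial := (wpartial Omega).
Local Notation laplacian := (laplacian Omega).
Local Notation grad_norm := (grad_norm Omega).
Variables (ev : nat -> R) (e : nat -> 'rV[R]_n -> R[i]).
Hypothesis He : dirichlet_eigenbasis Omega ev e.
Implicit Types (f g u v : 'rV[R]_n -> R[i]).

Let sep : L2_separating Omega := eigenbasis_separating mO He.

Let in_L2_e k : in_L2 (e k).
Proof. by have [[]] := He. Qed.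

Let inner_e k l : inner (e k) (e l) = (k == l)%:R.
Proof. by have [[_ + _] _ _ _ _] := He; exact. Qed.

Definition eproj m f : 'rV[R]_n -> R[i] :=
  fun x => \sum_(k < m) inner f (e k) * e k x.

Lemma in_L2_proj m f : in_L2 (eproj m f).
Proof. by apply: in_L2_sum => // k; exact: in_L2Z. Qed.

Lemma inner_projr m f g : in_L2 g ->
  inner g (eproj m f) = \sum_(k < m) (inner f (e k))^* * inner g (e k).
Proof.
move=> hg; rewrite inner_sumr//; last by move=> k; exact: in_L2Z.
by apply: eq_bigr => k _; rewrite innerZr.
Qed.

(** By orthonormality [(Pf, Pf) = (f, Pf)]. Bessel's inequality and Parseval's identity both follow
    from this Pythagorean relation. *)
Lemma sqr_L2norm_subproj m f : in_L2 f -> L2norm (fun x => f x - eproj m f x) ^+ 2 =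
  L2norm f ^+ 2 - \sum_(k < m) normc (inner f (e k)) ^+ 2.
Proof.
move=> hf; have hp := in_L2_proj m f.
have reS : Re (inner f (eproj m f)) = \sum_(k < m) normc (inner f (e k)) ^+ 2.
  rewrite inner_projr// (big_morph Re (@cReD R) (erefl _)); apply: eq_bigr => k _.
  by rewrite cReM cReJ cImJ mulNr opprK -!expr2 sqr_normcE.
have e1 : inner (eproj m f) (eproj m f) = inner f (eproj m f).
  rewrite !inner_projr//; apply: eq_bigr => k _; congr (_ * _).
  rewrite inner_suml//; last by move=> l; exact: in_L2Z.
  rewrite (bigD1 k)//= innerZl// inner_e eqxx mulr1 big1 ?addr0// => l lk.
  have /negbTE lk' : l != k :> nat by [].
  by rewrite innerZl// inner_e lk' mulr0.
have hN := in_L2N mO hp.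
rewrite (sqr_L2normD mO hf hN) innerNr// cReN reS.
rewrite [L2norm (fun x => - _) ^+ 2]sqr_L2normE// innerNl// innerNr// opprK e1 reS.
ring.
Qed.

Lemma bessel m f : in_L2 f ->
  \sum_(k < m) normc (inner f (e k)) ^+ 2 <= L2norm f ^+ 2.
Proof. by move=> hf; rewrite -subr_ge0 -sqr_L2norm_subproj// sqr_ge0. Qed.

Lemma cvg_L2norm_subproj f : in_L2 f ->
  L2norm (fun x => f x - eproj m f x) @[m --> \oo] --> (0 : R).
Proof. by have [[_ _ +] _ _ _ _] := He; exact. Qed.

Lemma parseval f : in_L2 f ->
  \sum_(k < m) normc (inner f (e k)) ^+ 2 @[m --> \oo] --> L2norm f ^+ 2.
Proof.
move=> hf; have h := cvg_L2norm_subproj hf.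
set r := (fun m => _) in h.
have h2 : L2norm f ^+ 2 - r m * r m @[m --> \oo] --> L2norm f ^+ 2 - 0 * 0.
  by apply: cvgB; [exact: cvg_cst|exact: cvgM].
rewrite mulr0 subr0 in h2.
rewrite (_ : (fun m => _) = (fun m => L2norm f ^+ 2 - r m * r m))//.
by apply/funext => m; rewrite -expr2 sqr_L2norm_subproj// subKr.
Qed.

Lemma cvg_Re_inner_proj f g : in_L2 f -> in_L2 g ->
  Re (inner g (eproj m f)) @[m --> \oo] --> Re (inner g f).
Proof.
move=> hf hg; have h := cvg_L2norm_subproj hf.
have h2 : L2norm g * L2norm (fun x => f x - eproj m f x) @[m --> \oo] --> (0 : R).
  by rewrite -(mulr0 (L2norm g)); exact: cvgMr.
apply/cvgrPdist_le => eps eps0; move/cvgrPdist_le : h2 => /(_ _ eps0).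
apply: filterS => m; rewrite sub0r normrN => h3; apply: le_trans h3.
have hp := in_L2_proj m f.
have -> : Re (inner g f) - Re (inner g (eproj m f)) =
    Re (inner g (fun x => f x - eproj m f x)).
  by rewrite innerBr// cReD cReN.
have hB := in_L2B mO hf hp.
rewrite [leRHS]ger0_norm ?mulr_ge0 ?L2norm_ge0//.
exact: normr_Re_inner_le.
Qed.

Section domain.
Variable u : 'rV[R]_n -> R[i].
Hypotheses (u2 : in_H2 u) (u1 : in_H10 u).

Let Lu : in_L2 u. Proof. exact: u1.1.1. Qed.
Let LDu : in_L2 (laplacian u). Proof. exact: in_L2_laplacian. Qed.

(** Green's formula tested with [e k] meets the weak eigenvalue equation tested with [u]. The latter
    has its arguments in the opposite order, hence the conjugation, which leaves the real number
    [ev k] unchanged. *)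
Lemma inner_laplacian_e k : inner (laplacian u) (e k) = - (ev k)%:C * inner u (e k).
Proof.
have [_ /(_ k)[ek1 hk] _ _ _] := He.
rewrite -[LHS]opprK -(green mO sep u2 ek1) mulNr; congr (- _).
have h := congr1 (@conjc R) (hk u u1).
rewrite (innerC mO Lu (in_L2_e k)) -[X in X * _]conjc_real.
apply: etrans (etrans h (rmorphM _ _ _)).
rewrite rmorph_sum; apply: eq_bigr => j _.
by apply: innerC => //; apply: in_L2_wpartial => //; [exact: u1.1|exact: ek1.1].
Qed.

Lemma inner_laplacian_self : inner (laplacian u) u = - (grad_norm u ^+ 2)%:C.
Proof. by rewrite (sqr_grad_norm mO u1.1) (green mO sep u2 u1) opprK. Qed.

(** The squared gradient norm is [- Re (Delta u, u)], and in this pairing [u] may be replaced by its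
    L^2 expansion; convergence of the expansion in H^1 is thereby avoided. *)
Lemma cvg_grad_norm :
  \sum_(k < m) ev k * normc (inner u (e k)) ^+ 2 @[m --> \oo] --> grad_norm u ^+ 2.
Proof.
have -> : grad_norm u ^+ 2 = - Re (inner (laplacian u) u).
  by rewrite inner_laplacian_self cReN opprK.
have h : - Re (inner (laplacian u) (eproj m u)) @[m --> \oo] -->
    - Re (inner (laplacian u) u).
  by apply: cvgN; exact: cvg_Re_inner_proj.
rewrite (_ : (fun m => _) = fun m => - Re (inner (laplacian u) (eproj m u)))//.
apply/funext => m; rewrite inner_projr// (big_morph Re (@cReD R) (erefl _)).
rewrite -sumrN; apply: eq_bigr => k _; rewrite inner_laplacian_e sqr_normcE.
by rewrite !(cReM, cImM, cReN, cImN, cReJ, cImJ) /=; ring.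
Qed.

Let nev k : 0 <= ev k.
Proof.
have [_ _ ev0 hev _] := He.
by rewrite ltW// (lt_le_trans ev0)// hev.
Qed.

Lemma weighted_sum_le_grad m :
  \sum_(k < m) ev k * normc (inner u (e k)) ^+ 2 <= grad_norm u ^+ 2.
Proof.
rewrite -(cvg_lim _ cvg_grad_norm)//; apply: (nondecreasing_cvgn_le
  (u_ := fun m => \sum_(k < m) ev k * normc (inner u (e k)) ^+ 2)).
  apply/nondecreasing_seqP => k; rewrite big_ord_recr/= lerDl.
  by rewrite mulr_ge0// sqr_ge0.
by apply/cvg_ex; exists (grad_norm u ^+ 2); exact: cvg_grad_norm.
Qed.

(** The coefficients of [laplacian u] are [- ev k * u_k], so this is Bessel's inequality for the
    Laplacian. *)
Lemma weighted_sum_le_laplacian m :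
  \sum_(k < m) ev k * (ev k * normc (inner u (e k)) ^+ 2) <= L2norm (laplacian u) ^+ 2.
Proof.
apply: le_trans (bessel m LDu); rewrite le_eqVlt; apply/orP; left; apply/eqP.
apply: eq_bigr => k _; rewrite inner_laplacian_e !sqr_normcE.
by rewrite !(cReM, cImM, cReN, cImN) /=; ring.
Qed.

Lemma poincare : ev 0%N * L2norm u ^+ 2 <= grad_norm u ^+ 2.
Proof.
have [_ _ ev0 hev _] := He.
apply: (first_weight_le (a := fun k => normc (inner u (e k)) ^+ 2) hev _
  (parseval Lu) weighted_sum_le_grad) => k.
exact: sqr_ge0.
Qed.

Lemma poincare_laplacian : ev 0%N * grad_norm u ^+ 2 <= L2norm (laplacian u) ^+ 2.
Proof.
have [_ _ ev0 hev _] := He.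
apply: (first_weight_le (a := fun k => ev k * normc (inner u (e k)) ^+ 2) hev _
  cvg_grad_norm weighted_sum_le_laplacian) => k.
by rewrite mulr_ge0// sqr_ge0.
Qed.

Lemma spectral_gap (gamma m : R) N : 0 < gamma -> gamma <= m ->
  gamma * L2norm u ^+ 2 - m * \sum_(k < N) normc (inner u (e k)) ^+ 2 <=
  gamma * (ev N)^-1 * grad_norm u ^+ 2.
Proof.
have [_ _ ev0 hev _] := He => g0 gm.
apply: (weighted_tail_le (a := fun k => normc (inner u (e k)) ^+ 2) ev0 hev _
  (parseval Lu) weighted_sum_le_grad) => // k.
exact: sqr_ge0.
Qed.

Lemma spectral_gap_laplacian (gamma m : R) N : 0 < gamma -> gamma <= m ->
  gamma * grad_norm u ^+ 2 - m * \sum_(k < N) ev k * normc (inner u (e k)) ^+ 2 <=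
  gamma * (ev N)^-1 * L2norm (laplacian u) ^+ 2.
Proof.
have [_ _ ev0 hev _] := He => g0 gm.
apply: (weighted_tail_le (a := fun k => ev k * normc (inner u (e k)) ^+ 2) ev0
  hev _ cvg_grad_norm weighted_sum_le_laplacian) => // k.
by rewrite mulr_ge0// sqr_ge0.
Qed.

End domain.

End eigenexpansion.

(** * Differential inequalities *)

Section right_derivatives.
Variable R : realType.
Implicit Types (y z dy dz : R -> R) (a b t : R).

Definition diff_on_nonneg y dy := forall t, 0 <= t ->
  (y s - y t) / (s - t) @[s --> within [set s | 0 <= s] t^'] --> dy t.

(** What monotonicity on a closed interval [[a, b]] consumes: two-sided derivatives inside and, when
    [a = 0], right continuity at the end. *)
Definition diff_on_pos y dy :=
  (forall t, 0 < t -> is_derive t 1 y (dy t)) /\ y s @[s --> 0^'+] --> y 0.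

Lemma diff_on_nonneg_pos y dy : diff_on_nonneg y dy -> diff_on_pos y dy.
Proof.
move=> h; split.
  move=> t t0; have ht := h t (ltW t0).
  have c : h^-1 *: ((y \o shift t) (h *: 1) - y t) @[h --> 0^'] --> dy t.
    (* A radius of at most [t] keeps [k + t] in the half-line on which the given limit is taken. *)
    apply: cvg_trans ht => A /= [e /= e0 eA]; exists (Num.min e t) => /=.
      by rewrite lt_min e0.
    move=> k /=; rewrite sub0r normrN lt_min => /andP[ke kt] k0.
    rewrite (_ : _ *: _ = (y (k + t) - y t) / (k + t - t)); last first.
      by rewrite addrK [k%:A]mulr1 [LHS]mulrC.
    apply: eA => /=; first by rewrite opprD addrCA subrr addr0 normrN.
      by rewrite -subr_eq0 addrK.
    by move: kt; rewrite ltr_norml => /andP[]; lra.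
  split; first by apply/cvg_ex; exists (dy t).
  exact: cvg_lim c.
have q0 : (y s - y 0) / (s - 0) @[s --> 0^'+] --> dy 0.
  apply: cvg_trans (h 0 (lexx 0)) => A /= [e /= e0 eA]; exists e => //= s se s0.
  by apply: eA => //; [rewrite gt_eqF|exact: ltW].
(* Right continuity at 0: [y s] is [y 0] plus [s] times a convergent quotient. *)
have : y 0 + s * ((y s - y 0) / (s - 0)) @[s --> 0^'+] --> y 0 + 0 * dy 0.
  apply: cvgD; first exact: cvg_cst.
  by apply: cvgM => //; exact/cvg_at_right_filter/cvg_id.
rewrite mul0r addr0; apply: cvg_trans; apply: near_eq_cvg; near=> s.
by rewrite subr0 mulrC divfK ?gt_eqF// addrC subrK.
Unshelve. all: by end_near. Qed.

Lemma diff_on_pos_continuous y dy a b :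
  diff_on_pos y dy -> 0 <= a -> a < b -> {within `[a, b], continuous y}.
Proof.
move=> [dy_ y0] a0 ab.
have c t : 0 < t -> {for t, continuous y}.
  move=> /dy_ [d _]; exact/differentiable_continuous/derivable1_diffP.
apply/continuous_within_itvP => //; split.
- by move=> t; rewrite in_itv/= => /andP[at_ _]; apply: c; exact: le_lt_trans at_.
- move: a0; rewrite le_eqVlt => /predU1P[<-//|a0].
  exact/cvg_at_right_filter/c.
- exact/cvg_at_left_filter/c/(le_lt_trans a0 ab).
Qed.

Lemma diff_on_pos_nincr z dz a b : diff_on_pos z dz -> 0 <= a -> a <= b ->
  (forall t, a < t -> dz t <= 0) -> z b <= z a.
Proof.
move=> hz a0; rewrite le_eqVlt => /predU1P[->//|ab] dz0.
have d t : t \in `]a, b[ -> is_derive t 1 z (dz t).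
  by rewrite in_itv/= => /andP[at_ _]; apply: hz.1; exact: le_lt_trans at_.
apply: (@ler0_derive1_le_cc _ z a b).
- by move=> t /d [].
- move=> t tab; have [_ dv] := d t tab; rewrite derive1E dv dz0//.
  by move: tab; rewrite in_itv/= => /andP[].
- exact: diff_on_pos_continuous hz a0 ab.
- by rewrite in_itv/= lexx ltW.
- by rewrite in_itv/= lexx ltW.
- exact: ltW.
Qed.

Lemma diff_on_pos_expR y dy (delta : R) : diff_on_pos y dy ->
  diff_on_pos (fun t => expR (delta * t) * y t)
    (fun t => expR (delta * t) * (delta * y t + dy t)).
Proof.
move=> [d y0].
have de t : is_derive t 1 (fun t => expR (delta * t)) (expR (delta * t) * delta).
  by apply: is_derive_eq; rewrite [delta%:A]mulr1.
split.
  move=> t t0; have dt := d t t0; have det := de t.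
  apply: is_derive_eq; rewrite /GRing.scale/=; ring.
apply: cvgM => //.
apply: cvg_at_right_filter.
by have [/derivable1_diffP/differentiable_continuous] := de 0.
Qed.

(** The factor [exp (delta t)] makes the product nonincreasing. The inequality is asked only after
    [a], because for [a = 0] the equation says nothing at time 0. *)
Lemma gronwall_nonneg y dy (delta a b : R) : diff_on_pos y dy -> 0 <= a -> a <= b ->
  (forall t, a < t -> dy t <= - (delta * y t)) ->
  y b <= expR (- (delta * (b - a))) * y a.
Proof.
move=> hy a0 ab hd.
have := diff_on_pos_nincr (diff_on_pos_expR delta hy) a0 ab.
have {}hd t : a < t -> expR (delta * t) * (delta * y t + dy t) <= 0.
  move=> /hd h; rewrite pmulr_rle0 ?expR_gt0//; lra.
move=> /(_ hd); rewrite -ler_pdivlMl ?expR_gt0// -expRN mulrA -expRD.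
by rewrite (_ : - (delta * b) + delta * a = - (delta * (b - a)))//; ring.
Qed.

(** The interval ends at [T + 1] so as to be nondegenerate even for [T = 0]. The constant has [Y 0]
    in its denominator, which is why the case [Y 0 = 0] enters through a separate hypothesis. *)
Lemma exp_decay_from_late_times (Y : R -> R) (delta T : R) :
  0 < delta -> 0 <= T -> {within `[0, T + 1], continuous Y} ->
  (forall t, 0 <= Y t) -> (Y 0 = 0 -> forall t, 0 <= t -> Y t = 0) ->
  (forall t, T <= t -> Y t <= expR (- (delta * (t - T))) * Y T) ->
  exists C, 0 < C /\ forall t, 0 <= t -> Y t <= C * expR (- (delta * t)) * Y 0.
Proof.
move=> d0 T0 cY Y0 Yz hT.
have [z0|nz0] := eqVneq (Y 0) 0.
  by exists 1; split=> // t t0; rewrite (Yz z0 t t0) z0 mulr0.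
have Yp : 0 < Y 0 by rewrite lt0r nz0 Y0.
have T1 : 0 < T + 1 by rewrite ltr_wpDl.
have TT1 : T < T + 1 by rewrite ltrDl.
have [c _ hc] := EVT_max (ltW T1) cY.
have YcT : Y T <= Y c by apply: hc; rewrite in_itv/= T0 ltW.
have Yc0 : 0 < Y c.
  by apply: lt_le_trans Yp _; apply: hc; rewrite in_itv/= lexx ltW.
(* [exp (delta T)] compensates the delay: up to time [T] the remaining exponential is at least 1,
   and the maximum [Y c] dominates [Y] there as well as [Y T]. *)
exists (expR (delta * T) * (Y c / Y 0)); split.
  by rewrite mulr_gt0 ?expR_gt0// divr_gt0.
move=> t t0.
have -> : expR (delta * T) * (Y c / Y 0) * expR (- (delta * t)) * Y 0 =
    expR (- (delta * (t - T))) * Y c.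
  by rewrite mulrBr opprB expRD; field.
have [Tt|tT] := leP T t.
  by apply: le_trans (hT t Tt) _; rewrite ler_wpM2l ?expR_ge0.
apply: (@le_trans _ _ (Y c)).
  by apply: hc; rewrite in_itv/= t0 ltW// (lt_trans tT).
rewrite ler_peMl ?(ltW Yc0)// -expR0 ler_expR oppr_ge0.
by rewrite pmulr_rle0// subr_le0 ltW.
Qed.

End right_derivatives.

(** * Differentiating a squared L^2 norm along a curve *)

Section L2_derivative.
Variables (R : realType) (n : nat) (Omega : set 'rV[R]_n).
Hypothesis mO : measurable Omega.
Local Open Scope complex_scope.
Local Notation inner := (inner Omega).
Local Notation L2norm := (L2norm Omega).
Local Notation in_L2 := (in_L2 Omega).
Local Notation Re := (@complex.Re R).

(** Writing [w s = w t + h (dw + D)] with [|D| -> 0], the quotient misses its limit by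
    [2 Re (w t, D) + h |dw + D|^2]. The curve [w] is general so as to cover both [u] and its partial
    derivatives. *)
Lemma sqr_L2norm_quotient (w : R -> 'rV[R]_n -> R[i]) (dw : 'rV[R]_n -> R[i]) t :
  0 <= t -> (forall s, 0 <= s -> in_L2 (w s)) -> in_L2 dw ->
  L2norm (fun x => (s - t)^-1%:C * (w s x - w t x) - dw x)
    @[s --> within [set s | 0 <= s] t^'] --> (0 : R) ->
  (L2norm (w s) ^+ 2 - L2norm (w t) ^+ 2) / (s - t)
    @[s --> within [set s | 0 <= s] t^'] --> 2 * Re (inner dw (w t)).
Proof.
move=> t0 hw hdw; set r := (fun s => L2norm _) => hr.
have hwt := hw t t0.
set F := within _ _.
have st0 : s - t @[s --> F] --> 0.
  rewrite -(subrr t); apply: cvgB; last exact: cvg_cst.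
  by apply: cvg_within_filter; apply: cvg_within_filter; exact: cvg_id.
have c0 : L2norm dw + r s @[s --> F] --> L2norm dw + 0.
  by apply: cvgD => //; exact: cvg_cst.
have b0 : 2 * (L2norm (w t) * r s) +
      `|s - t| * ((L2norm dw + r s) * (L2norm dw + r s))
    @[s --> F] --> 2 * (L2norm (w t) * 0) +
      `|0 : R| * ((L2norm dw + 0) * (L2norm dw + 0)).
  apply: cvgD; first by apply: cvgMr; apply: cvgMr.
  by apply: cvgM; [exact: cvg_norm|exact: cvgM].
rewrite !mulr0 normr0 mul0r addr0 in b0.
apply/cvgrPdist_le => eps eps0; move/cvgrPdist_le : b0 => /(_ _ eps0).
have hF : \forall s \near F, s != t /\ 0 <= s by exists 1 => //= s _ st s0.
apply: filterS2 hF => s [st s0]; rewrite sub0r normrN => hs.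
pose h := s - t; have h0 : h != 0 by rewrite subr_eq0.
pose D x := h^-1%:C * (w s x - w t x) - dw x.
have hD : in_L2 D.
  by apply: in_L2B => //; apply: in_L2Z => //; apply: in_L2B => //; exact: hw.
have hv := in_L2D mO hdw hD.
have wsE : w s = fun x => w t x + h%:C * (dw x + D x).
  apply/funext => x; rewrite /D [dw x + _]addrC subrK mulrA -rmorphM divff//.
  by rewrite rmorph1 mul1r addrC subrK.
have -> : 2 * Re (inner dw (w t)) - (L2norm (w s) ^+ 2 - L2norm (w t) ^+ 2) / (s - t) =
    - (2 * Re (inner (w t) D) + h * L2norm (fun x => dw x + D x) ^+ 2).
  rewrite {1}wsE sqr_L2normD//; last exact: in_L2Z.
  rewrite innerZr// L2normZ// innerDr// (Re_inner_sym mO hdw hwt).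
  rewrite cReM cReJ cImJ cReD /= oppr0 mul0r subr0 exprMn real_normK ?num_real// -/h.
  by field.
rewrite normrN; apply: le_trans (ler_normD _ _) _.
rewrite (le_trans _ (le_trans (ler_norm _) hs))// lerD//.
  by rewrite normrM ger0_norm// ler_pM2l//; exact: normr_Re_inner_le.
rewrite normrM ler_wpM2l// ger0_norm ?sqr_ge0// -expr2.
rewrite lerXn2r ?nnegrE ?addr_ge0 ?L2norm_ge0//.
exact: L2normD_le.
Qed.

End L2_derivative.

(** * The controlled equation *)

Section nonlinearity.
Variables (R : realType) (n : nat) (Omega : set 'rV[R]_n).
Hypothesis mO : measurable Omega.
Local Open Scope complex_scope.
Local Notation mu := (lebesgue_rV R n).
Local Notation inner := (inner Omega).
Local Notation L2norm := (L2norm Omega).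
Local Notation in_L2 := (in_L2 Omega).
Local Notation in_H10 := (in_H10 Omega).
Local Notation in_H2 := (in_H2 Omega).
Local Notation Re := (@complex.Re R).
Local Notation Im := (@complex.Im R).
Local Notation laplacian := (laplacian Omega).
Local Notation grad_norm := (grad_norm Omega).
Variable p : R.
Hypothesis p0 : 0 < p.
Implicit Types f u : 'rV[R]_n -> R[i].

(** Convertible to the [let]-bound nonlinearity of [cgl_solution]. *)
Definition nonlin f : 'rV[R]_n -> R[i] := fun x => (normc (f x) `^ p)%:C * f x.

Lemma normc_nonlin f x : normc (nonlin f x) = normc (f x) `^ (p + 1).
Proof.
have h : normc (normc (f x) `^ p)%:C = normc (f x) `^ p.
  by rewrite /= expr0n addr0 sqrtr_sqr ger0_norm// powR_ge0.
rewrite normcM h powRD; last by rewrite gt_eqF// addr_gt0.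
by rewrite powRr1// normc_ge0.
Qed.

(** This fixes [2 (p + 1)] as the exponent for the Gagliardo-Nirenberg inequality. *)
Lemma Lp_norm_nonlin f :
  Lp_norm Omega 2 (nonlin f) = (Lp_norm Omega (2 * (p + 1)) f `^ (p + 1))%E.
Proof.
have p1 : 0 < p + 1 by rewrite addr_gt0.
rewrite !Lp_normE ?gt_eqF ?mulr_gt0// -poweRrM.
rewrite (_ : (2 * (p + 1))^-1 * (p + 1) = 2^-1); last first.
  by rewrite invfM -mulrA mulVf ?mulr1// gt_eqF.
congr (_ `^ _)%E; apply: eq_integral => x _.
by rewrite normc_nonlin -powRrM mulrC.
Qed.

Lemma L2norm_nonlin_le f (B : R) :
  (Lp_norm Omega (2 * (p + 1)) f <= B%:E)%E -> L2norm (nonlin f) <= B `^ (p + 1).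
Proof.
rewrite /Defs.L2norm Lp_norm_nonlin; have : (0 <= Lp_norm Omega (2 * (p + 1)) f)%E.
  exact: Lnorm_ge0.
case: (Lp_norm _ _ f) => [r||]//=; rewrite !lee_fin => r0 rB.
apply: ge0_ler_powR; rewrite ?nnegrE//; last exact: le_trans rB.
by rewrite ltW// addr_gt0.
Qed.

(** The integrand is [|f|^p |f|^2], real and nonnegative. Together with the next lemma this removes
    [beta] from the L^2 estimate and gives the [kappa] term its sign. *)
Lemma Im_inner_nonlin f : Im (inner (nonlin f) f) = 0.
Proof.
rewrite /= (@eq_Rintegral _ _ _ mu Omega (fun=> 0)) ?Rintegral_cst ?mul0r// => x _.
rewrite /nonlin !(cReM, cImM, cReJ, cImJ) /=; ring.
Qed.

Lemma Re_inner_nonlin_ge0 f : 0 <= Re (inner (nonlin f) f).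
Proof.
apply: Rintegral_ge0 => x _; rewrite /nonlin !(cReM, cImM, cReJ, cImJ) /=.
have := powR_ge0 (normc (f x)) p; have := sqr_ge0 (Re (f x)).
have := sqr_ge0 (Im (f x)); set a := _ `^ _; set b := Re _; set c := Im _; nra.
Qed.

Variables (ev : nat -> R) (e : nat -> 'rV[R]_n -> R[i]).
Hypothesis He : dirichlet_eigenbasis Omega ev e.
Hypothesis Hreg : regular_boundary Omega.
Hypothesis pn : p * n%:R <= 4.

(* Gagliardo-Nirenberg yields |u|_{L^(2p+2)}^(p+1) <= C |u|_{H^2}^r |u|^(p+1-r)
   with r = np/4 <= 1, and one factor |u|^(1-r) is absorbed by |Delta u|^(1-r). *)
Lemma nonlin_le_laplacian : exists2 K, 0 <= K & forall u, in_H2 u -> in_H10 u ->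
  L2norm (nonlin u) <= K * (L2norm u `^ p * L2norm (laplacian u)).
Proof.
have [[C0 hC0] gn] := Hreg.
have p1 : 0 < p + 1 by rewrite addr_gt0.
pose s := 2 * (p + 1); pose theta := n%:R / 2 * (2^-1 - s^-1).
pose r := theta * (p + 1).
have rE : r = p * n%:R / 4.
  by rewrite /r /theta /s; field; rewrite gt_eqF.
have r0 : 0 <= r by rewrite rE divr_ge0// mulr_ge0// ltW.
have r1 : r <= 1 by rewrite rE ler_pdivrMr// mul1r.
have th0 : 0 <= theta by rewrite -(pmulr_lge0 _ p1).
have th1 : theta < 1.
  (* Here [theta (p + 1) = r <= 1 < p + 1]. *)
  by rewrite -(ltr_pM2r p1) mul1r (le_lt_trans r1)// ltrDr.
have [|C1 hC1] := gn s theta _ erefl th1.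
  by rewrite /s ler_peMr// lerDr ltW.
have ev0 : 0 < ev 0%N by have [_ _ ->] := He.
exists (`|C1| `^ (p + 1) * (`|C0| `^ r * (ev 0%N)^-1 `^ (1 - r))).
  by rewrite !mulr_ge0// powR_ge0.
move=> u u2 u1; set h := L2norm u; set Z := L2norm (laplacian u).
have hh : 0 <= h by exact: L2norm_ge0.
have Z0 : 0 <= Z by exact: L2norm_ge0.
(* The two Poincare inequalities chained: [ev 0 ^ 2 * |u|^2 <= ev 0 * |grad u|^2 <= |Delta u|^2]. *)
have hZ : h <= (ev 0%N)^-1 * Z.
  rewrite ler_pdivlMl// -(@ler_pXn2r _ 2) ?nnegrE//; last first.
    by rewrite mulr_ge0// ltW.
  rewrite exprMn expr2 -mulrA; apply: le_trans (poincare_laplacian mO He u2 u1).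
  by rewrite ler_pM2l//; exact: (poincare mO He u2 u1).
(* Absolute values, because the two estimates leave the signs of [C0] and [C1] open. *)
pose B := `|C1| * (`|C0| * Z) `^ theta * h `^ (1 - theta).
have hB : (Lp_norm Omega s u <= B%:E)%E.
  apply: le_trans (hC1 u u2 u1) _; rewrite lee_fin /B ler_wpM2r ?powR_ge0//.
  apply: le_trans (ler_wpM2r (powR_ge0 _ _) (ler_norm C1)) _.
  rewrite ler_wpM2l//; apply: ge0_ler_powR => //.
  - by rewrite nnegrE sqrtr_ge0.
  - by rewrite nnegrE mulr_ge0.
  - by apply: le_trans (hC0 u u2 u1) _; rewrite ler_wpM2r// ler_norm.
apply: le_trans (L2norm_nonlin_le hB) _.
have -> : B `^ (p + 1) =
    `|C1| `^ (p + 1) * (`|C0| `^ r * Z `^ r) * (h `^ p * h `^ (1 - r)).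
  rewrite /B !powRM ?mulr_ge0 ?powR_ge0// -!powRrM -/r -powRD.
    congr (_ * _ `^ _); rewrite mulrBl mul1r -/r; lra.
  by rewrite gt_eqF// ltr_wpDr// subr_ge0.
have ZE : Z `^ r * Z `^ (1 - r) = Z.
  rewrite -powRD; last by rewrite addrC subrK oner_eq0.
  by rewrite addrC subrK powRr1.
have iev0 : 0 <= (ev 0%N)^-1 by rewrite invr_ge0 ltW.
have h1 : h `^ (1 - r) <= (ev 0%N)^-1 `^ (1 - r) * Z `^ (1 - r).
  rewrite -powRM//; apply: ge0_ler_powR => //.
  - by rewrite subr_ge0.
  - by rewrite nnegrE mulr_ge0.
rewrite -{2}ZE; set a := _ `^ (p + 1); set b := `|C0| `^ r; set c := (ev 0%N)^-1 `^ (1 - r).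
set d := Z `^ r; set f := h `^ p.
rewrite (_ : a * (b * c) * _ = a * (b * d) * (f * (c * Z `^ (1 - r)))); last by ring.
by rewrite !ler_wpM2l// ?mulr_ge0// powR_ge0.
Qed.

End nonlinearity.

(** * Energy estimates at a fixed time *)

Section energy_identities.
Variables (R : realType) (n : nat) (Omega : set 'rV[R]_n).
Hypothesis mO : measurable Omega.
Local Open Scope complex_scope.
Local Notation mu := (lebesgue_rV R n).
Local Notation inner := (inner Omega).
Local Notation L2norm := (L2norm Omega).
Local Notation in_L2 := (in_L2 Omega).
Local Notation in_H10 := (in_H10 Omega).
Local Notation in_H2 := (in_H2 Omega).
Local Notation Re := (@complex.Re R).
Local Notation Im := (@complex.Im R).
Local Notation laplacian := (laplacian Omega).
Local Notation grad_norm := (grad_norm Omega).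
Variables (ev : nat -> R) (e : nat -> 'rV[R]_n -> R[i]).
Hypothesis He : dirichlet_eigenbasis Omega ev e.
Variables (p lambda alpha kappa beta gamma m : R) (N : nat).
Hypotheses (kappa0 : 0 < kappa) (gamma0 : 0 < gamma) (gm : gamma <= m).
Variables u ut : 'rV[R]_n -> R[i].
Hypotheses (u2 : in_H2 u) (u1 : in_H10 u) (Lut : in_L2 ut).
Hypothesis Lnl : in_L2 (nonlin p u).
Hypothesis eqn : \forall x \ae mu, Omega x ->
  ut x - (lambda +i* alpha) * laplacian u x + (kappa +i* beta) * nonlin p u x
    - gamma%:C * u x = - (m%:C * \sum_(k < N) inner u (e k) * e k x).

Let Lu : in_L2 u. Proof. exact: u1.1.1. Qed.
Let LDu : in_L2 (laplacian u).
Proof. exact: (in_L2_laplacian mO u2). Qed.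
Let Lp : in_L2 (eproj Omega e N u).
Proof. exact: (in_L2_proj mO He). Qed.
Let Le k : in_L2 (e k).
Proof. by have [[]] := He. Qed.

Lemma inner_equation v : in_L2 v -> inner ut v =
  ((lambda +i* alpha) * inner (laplacian u) v - (kappa +i* beta) * inner (nonlin p u) v)
  + (gamma%:C * inner u v - m%:C * inner (eproj Omega e N u) v).
Proof.
move=> hv.
have h1 := in_L2Z mO (lambda +i* alpha) LDu.
have h2 := in_L2Z mO (kappa +i* beta) Lnl.
have h3 := in_L2Z mO gamma%:C Lu.
have h4 := in_L2Z mO m%:C Lp.
have h12 := in_L2B mO h1 h2; have h34 := in_L2B mO h3 h4.
rewrite (@ae_eq_innerl _ _ _ mO _ _ v Lut (in_L2D mO h12 h34) hv).
  by rewrite innerDl// !innerBl// !innerZl.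
apply: filterS eqn => x h Ox; have {}h := h Ox.
have -> : eproj Omega e N u x = \sum_(k < N) inner u (e k) * e k x by [].
rewrite -[m%:C * _]opprK -h; ring.
Qed.

Let S := \sum_(k < N) normc (inner u (e k)) ^+ 2.

Lemma inner_proj_self : inner (eproj Omega e N u) u = S%:C.
Proof.
rewrite inner_suml//; last by move=> k; exact: in_L2Z.
rewrite rmorph_sum; apply: eq_bigr => k _.
rewrite innerZl// (innerC mO (Le k) Lu); apply: complex_ext.
  by rewrite cReM cReJ cImJ sqr_normcE /=; ring.
by rewrite cImM cReJ cImJ /=; ring.
Qed.

Lemma inner_proj_laplacian : inner (eproj Omega e N u) (laplacian u) =
  - (\sum_(k < N) ev k * normc (inner u (e k)) ^+ 2)%:C.
Proof.
rewrite inner_suml//; last by move=> k; exact: in_L2Z.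
rewrite rmorph_sum -sumrN; apply: eq_bigr => k _.
rewrite innerZl// (innerC mO (Le k) LDu) (inner_laplacian_e mO He u2 u1).
apply: complex_ext.
  by rewrite cReM cReJ cImJ cReN cReM cImM sqr_normcE /=; ring.
by rewrite cImM cReJ cImJ cImN cReM cImM /=; ring.
Qed.

(** The pairings of [laplacian u] and of the nonlinearity with [u] are real, so [alpha] and [beta]
    drop out; the [kappa] term is nonpositive and is discarded. *)
Lemma energy_L2 : Re (inner ut u) <=
  - ((lambda - gamma * (ev N)^-1) * grad_norm u ^+ 2).
Proof.
rewrite (inner_equation Lu) inner_proj_self inner_diag//.
rewrite (inner_laplacian_self mO He u2 u1).
have := spectral_gap mO He u2 u1 N gamma0 gm; rewrite -/S.
have := Re_inner_nonlin_ge0 Omega p u; have := Im_inner_nonlin mO p u.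
move: (inner (nonlin p u) u) => [a b] /= -> a0.
have := mulr_ge0 (ltW kappa0) a0.
by rewrite /=; lra.
Qed.

(** Against [laplacian u] the nonlinear pairing is in general neither real nor of one sign, so it is
    kept and bounded by Cauchy-Schwarz with the modulus of the whole coefficient. The other pairings
    are real, which removes [alpha]. *)
Lemma energy_grad : - Re (inner ut (laplacian u)) <=
  normc (kappa +i* beta) * (L2norm (nonlin p u) * L2norm (laplacian u))
  - (lambda - gamma * (ev N)^-1) * L2norm (laplacian u) ^+ 2.
Proof.
rewrite (inner_equation LDu) inner_proj_laplacian [inner (laplacian u) _]inner_diag//.
rewrite [inner u _]innerC// (inner_laplacian_self mO He u2 u1).
set Sk := \sum_(k < N) _.
have := spectral_gap_laplacian mO He u2 u1 N gamma0 gm; rewrite -/Sk.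
have : Re ((kappa +i* beta) * inner (nonlin p u) (laplacian u)) <=
    normc (kappa +i* beta) * (L2norm (nonlin p u) * L2norm (laplacian u)).
  apply: le_trans (le_trans (ler_norm _) (normr_Re_le_normc _)) _.
  by rewrite normcM ler_wpM2l ?normc_ge0// normc_inner_le.
set nb := normc (kappa +i* beta).
move: (_ * inner _ (laplacian u)) Sk => [a b] Sk /=; lra.
Qed.

End energy_identities.

(** * Time derivatives of the two energies *)

Section time_derivatives.
Variables (R : realType) (n : nat) (Omega : set 'rV[R]_n).
Hypothesis mO : measurable Omega.
Hypothesis sep : L2_separating Omega.
Local Open Scope complex_scope.
Local Notation mu := (lebesgue_rV R n).
Local Notation inner := (inner Omega).
Local Notation L2norm := (L2norm Omega).
Local Notation in_H1 := (in_H1 Omega).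
Local Notation Re := (@complex.Re R).
Local Notation wpartial := (wpartial Omega).
Variables (u ut : R -> 'rV[R]_n -> R[i]).
Hypotheses (hu : forall t, 0 <= t -> in_H1 (u t)) (hut : forall t, 0 <= t -> in_H1 (ut t)).
Hypothesis du : derivative_in (H1norm Omega) u ut.

Lemma diff_sqr_L2norm : diff_on_nonneg (fun t => L2norm (u t) ^+ 2)
  (fun t => 2 * Re (inner (ut t) (u t))).
Proof.
move=> t t0; apply: sqr_L2norm_quotient => //.
- by move=> s s0; exact: (hu s0).1.
- exact: (hut t0).1.
- apply: (@squeeze_cvgr _ _ _ _ (fun=> 0) _ _ _ _ _ (du t0)).
    by near=> s; rewrite L2norm_ge0 L2norm_le_H1norm.
  exact: cvg_cst.
Unshelve. all: by end_near. Qed.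

(** Componentwise, with [wpartial j (u s)] as the curve. Its difference quotient agrees only almost
    everywhere with the derivative of the quotient of [u], which suffices for equality of norms and
    so for control by the H^1 norm. *)
Lemma diff_sqr_grad_norm : diff_on_nonneg (fun t => grad_norm Omega (u t) ^+ 2)
  (fun t => \sum_j 2 * Re (inner (wpartial j (ut t)) (wpartial j (u t)))).
Proof.
move=> t t0.
have e : (fun s => (grad_norm Omega (u s) ^+ 2 - grad_norm Omega (u t) ^+ 2) / (s - t)) =
    (fun s => \sum_j (L2norm (wpartial j (u s)) ^+ 2 - L2norm (wpartial j (u t)) ^+ 2)
      / (s - t)).
  by apply/funext => s; rewrite (sqr_grad_normE _ (u s)) (sqr_grad_normE _ (u t)) -sumrB mulr_suml.
rewrite e; apply: cvg_big => [|j _]; first exact: add_continuous.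
apply: (sqr_L2norm_quotient mO (w := fun s => wpartial j (u s)) t0).
- by move=> s s0; apply: in_L2_wpartial; exact: hu.
- by apply: in_L2_wpartial; exact: hut.
- apply: (@squeeze_cvgr _ _ _ _ (fun=> 0) _ _ _ _ _ (du t0)).
    exists 1 => //= s _ st s0; rewrite L2norm_ge0/=.
    have [[hs ht] hdt] := (hu s0, hu t0, hut t0).
    have hb := in_H1B mO hs ht; have hz := in_H1Z mO (s - t)^-1%:C hb.
    apply: le_trans (L2norm_wpartial_le_H1norm _ j _).
    rewrite le_eqVlt; apply/orP; left; apply/eqP; apply: (ae_eq_L2norm mO).
    + apply: in_L2B => //; last exact: in_L2_wpartial.
      by apply: in_L2Z => //; apply: in_L2B => //; exact: in_L2_wpartial.
    + by apply: in_L2_wpartial; exact: in_H1B.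
    + apply: filterS3 (wpartialB mO sep j hz hdt)
        (wpartialZ mO sep j (s - t)^-1%:C hb) (wpartialB mO sep j hs ht).
      by move=> x e1 e2 e3 Ox; rewrite e1// e2// e3.
  exact: cvg_cst.
Unshelve. all: by end_near. Qed.

End time_derivatives.

Section ae_equal.
Variables (R : realType) (n : nat) (Omega : set 'rV[R]_n).
Hypothesis mO : measurable Omega.

(** The initial condition holds almost everywhere only. Functions that agree almost everywhere have
    the same set of weak derivatives, so the choice in [wpartial] returns the same representative
    for both. *)
Lemma ae_eq_grad_norm (f g : 'rV[R]_n -> R[i]) : in_L2 Omega f -> in_L2 Omega g ->
  ae_eqL2 Omega f g -> grad_norm Omega f = grad_norm Omega g.
Proof.
move=> hf hg fg; congr Num.sqrt; apply: eq_bigr => j _.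
rewrite /wpartial (_ : [set h | _] = [set h | in_L2 Omega h /\ weak_partial Omega j g h])//.
have e phi : test_fun Omega phi ->
    cintegral Omega (fun x => f x * (partial j phi x)%:C%C) =
    cintegral Omega (fun x => g x * (partial j phi x)%:C%C).
  move=> hp; apply: ae_eq_cintegralM => //.
  by apply: in_L2_test1 => //; exact: test_fun_partial.
apply/seteqP; split=> h [hh w]; split=> // phi hp.
  by rewrite -e// w.
by rewrite e// w.
Qed.

End ae_equal.

(** * Decay of solutions *)

Section decay.
Variables (R : realType) (n : nat) (Omega : set 'rV[R]_n).
Hypotheses (HOmega : bounded_domain Omega) (Hreg : regular_boundary Omega).
Local Open Scope complex_scope.
Local Notation mu := (lebesgue_rV R n).
Local Notation inner := (inner Omega).
Local Notation L2norm := (L2norm Omega).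
Local Notation grad_norm := (grad_norm Omega).
Local Notation Re := (@complex.Re R).
Variables (ev : nat -> R) (e : nat -> 'rV[R]_n -> R[i]).
Hypothesis He : dirichlet_eigenbasis Omega ev e.
Variables (p lambda kappa gamma alpha beta m : R) (N : nat).
Hypotheses (p0 : 0 < p) (lambda0 : 0 < lambda) (kappa0 : 0 < kappa)
  (gamma0 : 0 < gamma) (gm : gamma <= m) (HN : gamma / lambda < ev N).
Hypothesis pn : p * n%:R <= 4.
Variables (u0 : 'rV[R]_n -> R[i]) (u : R -> 'rV[R]_n -> R[i]).
Hypothesis Hu : cgl_solution Omega p lambda alpha kappa beta gamma m N e u0 u.

Let mO : measurable Omega.
Proof. by have [oO _ _ _] := HOmega; exact: open_measurable_rV. Qed.

Let sep := eigenbasis_separating mO He.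

Let u2 t : 0 <= t -> in_H2 Omega (u t).
Proof. by have [h _ _ _ _] := Hu; move=> /h[]. Qed.

Let u1 t : 0 <= t -> in_H10 Omega (u t).
Proof. by have [h _ _ _ _] := Hu; move=> /h[]. Qed.

Let rate := lambda - gamma * (ev N)^-1.

Let ev0 : 0 < ev 0%N.
Proof. by have [_ _ ->] := He. Qed.

Let evN : 0 < ev N.
Proof. by apply: lt_trans HN; rewrite divr_gt0. Qed.

Let rate0 : 0 < rate.
Proof. by rewrite subr_gt0 ltr_pdivrMr// mulrC -ltr_pdivrMr. Qed.

Lemma L2norm_decay t : 0 <= t -> L2norm (u t) ^+ 2 <=
  expR (- (2 * rate * ev 0%N * t)) * L2norm (u 0) ^+ 2.
Proof.
move=> t0; have [_ _ hnl _ [ut [hut _ du eqn]]] := Hu.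
have hu1 s : 0 <= s -> in_H1 Omega (u s) by move=> /u1[].
have hut1 s : 0 <= s -> in_H1 Omega (ut s) by move=> /hut[].
have hd := diff_on_nonneg_pos (diff_sqr_L2norm mO hu1 hut1 du).
have := @gronwall_nonneg _ _ _ (2 * rate * ev 0%N) 0 t hd (lexx 0) t0.
rewrite subr0; apply=> s s0.
have s0' := ltW s0.
have h := energy_L2 mO He kappa0 gamma0 gm (u2 s0') (u1 s0') (hut1 s s0').1
  (hnl s s0').1.1 (eqn s s0).
have := ler_wpM2l (ltW rate0) (poincare mO He (u2 s0') (u1 s0')).
by rewrite -/rate in h; lra.
Qed.

Lemma exists_time_small (eps : R) : 0 < eps ->
  exists2 T, 0 <= T & forall t, T <= t -> L2norm (u t) <= eps.
Proof.
move=> eps0; set w := 2 * rate * ev 0%N; set M := L2norm (u 0) ^+ 2.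
have w0 : 0 < w by rewrite !mulr_gt0.
have M0 : 0 <= M by exact: sqr_ge0.
(* With [exp x >= 1 + x], from this time on [exp (w t)] exceeds [M / eps^2]; no logarithm is
   involved. *)
exists (M / eps ^+ 2 / w); first by rewrite !divr_ge0 ?sqr_ge0 ?ltW.
move=> t Tt; have t0 : 0 <= t.
  by apply: le_trans Tt; rewrite !divr_ge0 ?sqr_ge0 ?ltW.
rewrite -(@ler_pXn2r _ 2) ?nnegrE ?L2norm_ge0 ?(ltW eps0)//.
apply: le_trans (L2norm_decay t0) _; rewrite -/w -/M.
rewrite expRN ler_pdivrMl ?expR_gt0// -ler_pdivrMr ?exprn_gt0//.
apply: le_trans (expR_ge1Dx _); rewrite -lerBlDl.
by move: Tt; rewrite ler_pdivrMr// => Tt; lra.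
Qed.

Lemma grad_norm_decay (delta : R) : 0 < delta < 2 * rate * ev 0%N ->
  exists2 T, 0 <= T & forall t, T <= t -> grad_norm (u t) ^+ 2 <=
    expR (- (delta * (t - T))) * grad_norm (u T) ^+ 2.
Proof.
move=> /andP[d0 dw]; have [_ _ hnl _ [ut [hut _ du eqn]]] := Hu.
have hu1 s : 0 <= s -> in_H1 Omega (u s) by move=> /u1[].
have hut1 s : 0 <= s -> in_H1 Omega (ut s) by move=> /hut[].
have hd := diff_on_nonneg_pos (diff_sqr_grad_norm mO sep hu1 hut1 du).
have [K K0 hK] := nonlin_le_laplacian mO p0 He Hreg pn.
set nb := normc (kappa +i* beta); have nb0 : 0 <= nb by exact: normc_ge0.
(* The share of the dissipation that decay at rate [delta] leaves free; the nonlinear term may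
   consume it. *)
pose eta := rate - delta / (2 * ev 0%N).
have eta0 : 0 < eta.
  by rewrite subr_gt0 ltr_pdivrMr ?mulr_gt0// mulrA [rate * 2]mulrC.
(* Chosen so that [nb * K * eps^p <= eta]; the [+ 1] keeps the denominator positive. *)
pose eps := (eta / (nb * K + 1)) `^ p^-1.
have q0 : 0 < nb * K + 1 by rewrite ltr_wpDl ?mulr_ge0.
have eps0 : 0 < eps by rewrite powR_gt0// divr_gt0.
have [T T0 hT] := exists_time_small eps0.
exists T => // t Tt; apply: (gronwall_nonneg hd) => // s Ts.
have s0 : 0 < s by exact: le_lt_trans Ts.
have s0' := ltW s0.
have h := energy_grad mO He gamma0 gm (u2 s0') (u1 s0') (hut1 s s0').1
  (hnl s s0').1.1 (eqn s s0).
(* The test function is [ut s], which lies in H^1_0; this turns the derivative of the gradient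
   energy into a pairing with [laplacian]. *)
have G := green mO sep (u2 s0') (hut s s0').
have -> : \sum_j 2 * Re (inner (wpartial Omega j (ut s)) (wpartial Omega j (u s))) =
    2 * - Re (inner (ut s) (laplacian Omega (u s))).
  have Lap := in_L2_laplacian mO (u2 s0').
  rewrite (Re_inner_sym mO (hut1 s s0').1 Lap) -cReN -G.
  rewrite (big_morph _ (@cReD R) (erefl _)) mulr_sumr; apply: eq_bigr => j _.
  have Lj1 := in_L2_wpartial j (hu1 s s0').
  have Lj2 := in_L2_wpartial j (hut1 s s0').
  exact: (congr1 (fun z => 2 * z) (Re_inner_sym mO Lj2 Lj1)).
have hp : L2norm (u s) `^ p <= eta / (nb * K + 1).
  have -> : eta / (nb * K + 1) = eps `^ p.
    by rewrite /eps -powRrM mulVf ?gt_eqF// powRr1// divr_ge0 ?ltW.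
  apply: ge0_ler_powR; rewrite ?nnegrE ?L2norm_ge0 ?(ltW p0) ?(ltW eps0)//.
  by apply: hT; exact: ltW.
have P := poincare_laplacian mO He (u2 s0') (u1 s0').
have hnlK := hK _ (u2 s0') (u1 s0').
set Z := L2norm (laplacian Omega (u s)) in h P hnlK *.
have Z0 : 0 <= Z by exact: L2norm_ge0.
set Y := grad_norm (u s) ^+ 2 in P *.
have h2 : nb * (L2norm (nonlin p (u s)) * Z) <= eta * Z ^+ 2.
  set q := eta / _ in hp.
  have hq : L2norm (nonlin p (u s)) <= K * (q * Z).
    by apply: le_trans hnlK _; rewrite ler_wpM2l// ler_wpM2r.
  have nbKq : nb * K * q <= eta.
    by rewrite /q mulrCA ger_pMr// ler_pdivrMr// mul1r lerDl.
  apply: (@le_trans _ _ (nb * (K * (q * Z) * Z))).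
    by rewrite ler_wpM2l// ler_wpM2r.
  rewrite (_ : nb * (K * (q * Z) * Z) = nb * K * q * Z ^+ 2); last by ring.
  by rewrite ler_wpM2r// sqr_ge0.
have h3 : - Re (inner (ut s) (laplacian Omega (u s))) <= - (delta / (2 * ev 0%N) * Z ^+ 2).
  by rewrite -/rate -/nb in h; rewrite /eta in h2; lra.
(* Poincare's inequality for the gradient converts the remaining dissipation into decay; the 2 in
   the denominator cancels against the one from differentiating a square. *)
have h4 : delta / (2 * ev 0%N) * (ev 0%N * Y) <= delta / (2 * ev 0%N) * Z ^+ 2.
  by rewrite ler_wpM2l// divr_ge0 ?mulr_ge0 ?ltW.
have h5 : delta / (2 * ev 0%N) * (ev 0%N * Y) = delta * Y / 2.
  by field; rewrite gt_eqF.
lra.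
Qed.

Lemma decay (delta : R) : 0 < delta < 2 * rate * ev 0%N ->
  exists C, 0 < C /\ forall t, 0 <= t ->
    grad_norm (u t) ^+ 2 <= C * expR (- (delta * t)) * grad_norm u0 ^+ 2.
Proof.
move=> hdelta; have [T T0 hT] := grad_norm_decay hdelta.
have [_ _ hnl [hu0 u00] [ut [hut _ du eqn]]] := Hu.
have hu1 s : 0 <= s -> in_H1 Omega (u s) by move=> /u1[].
have hut1 s : 0 <= s -> in_H1 Omega (ut s) by move=> /hut[].
have hd := diff_on_nonneg_pos (diff_sqr_grad_norm mO sep hu1 hut1 du).
rewrite -(ae_eq_grad_norm mO (hu1 0 (lexx 0)).1 hu0 u00).
have d0 : 0 < delta by case/andP: hdelta.
have cY := diff_on_pos_continuous hd (lexx 0) (ltr_wpDl T0 ltr01).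
have Y0 t : 0 <= grad_norm (u t) ^+ 2 by exact: sqr_ge0.
(* A vanishing initial gradient gives [u 0 = 0] in L^2 by Poincare, the L^2 decay propagates this,
   and [|grad u|^2 = - Re (Delta u, u)] then vanishes by Cauchy-Schwarz. *)
have Yz : grad_norm (u 0) ^+ 2 = 0 -> forall t, 0 <= t -> grad_norm (u t) ^+ 2 = 0.
  move=> z0 t t0; have l0 : L2norm (u t) = 0.
    apply/eqP; rewrite -sqrf_eq0 eq_le sqr_ge0 andbT.
    apply: le_trans (L2norm_decay t0) _; rewrite pmulr_rle0 ?expR_gt0//.
    have := poincare mO He (u2 (lexx 0)) (u1 (lexx 0)).
    by rewrite z0 pmulr_rle0.
  have Lap := in_L2_laplacian mO (u2 t0); have Lt := (hu1 t t0).1.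
  have := normr_Re_inner_le mO Lap Lt.
  rewrite l0 mulr0 (inner_laplacian_self mO He (u2 t0) (u1 t0)) cReN normrN => h.
  by apply/eqP; rewrite -normr_le0.
exact: (@exp_decay_from_late_times R (fun t => grad_norm (u t) ^+ 2) delta T d0
  T0 cY Y0 Yz hT).
Qed.

End decay.

Theorem theorem3p2 (R : realType) (n : nat) (n_gt0 : (0 < n)%N)
  (Omega : set 'rV[R]_n)
  (HOmega : bounded_domain Omega) (Hreg : regular_boundary Omega)
  (ev : nat -> R) (e : nat -> 'rV[R]_n -> R[i])
  (He : dirichlet_eigenbasis Omega ev e)
  (p lambda kappa gamma alpha beta mu : R)
  (p_gt0 : 0 < p) (lambda_gt0 : 0 < lambda) (kappa_gt0 : 0 < kappa)
  (gamma_gt0 : 0 < gamma) (mu_ge : gamma <= mu)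
  (N : nat) (N_gt0 : (0 < N)%N)
  (* [ev] is indexed from 0: [ev N] is lambda_(N+1), [ev 0] is lambda_1 *)
  (HN : gamma / lambda < ev N) :
  let omega := 2 * (lambda - gamma * (ev N)^-1) * ev 0%N in
  let solution := cgl_solution Omega p lambda alpha kappa beta gamma mu N e in
  (p < 4 / n%:R ->
     forall u0 u, solution u0 u ->
     forall delta : R, 0 < delta < omega ->
     exists C : R, 0 < C /\ forall t : R, 0 <= t ->
       grad_norm Omega (u t) ^+ 2
         <= C * expR (- (delta * t)) * grad_norm Omega u0 ^+ 2) /\
  (p = 4 / n%:R ->
     exists eta : R, 0 < eta /\
     forall u0 u, solution u0 u -> L2norm Omega u0 <= eta ->
     forall delta : R, 0 < delta < omega ->
     exists C : R, 0 < C /\ forall t : R, 0 <= t ->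
       grad_norm Omega (u t) ^+ 2
         <= C * expR (- (delta * t)) * grad_norm Omega u0 ^+ 2).
Proof.
move=> omega solution.
have n0 : 0 < n%:R :> R by rewrite ltr0n.
(* Both parts fall in the range where the interpolation power np/4 is at most 1. *)
have main u0 u delta : p <= 4 / n%:R -> solution u0 u -> 0 < delta < omega ->
    exists C : R, 0 < C /\ forall t : R, 0 <= t ->
      grad_norm Omega (u t) ^+ 2
        <= C * expR (- (delta * t)) * grad_norm Omega u0 ^+ 2.
  rewrite ler_pdivlMr// => pn hu.
  exact: (decay HOmega Hreg He p_gt0 lambda_gt0 kappa_gt0 gamma_gt0 mu_ge HN pn hu).
split=> [/ltW pn u0 u hu delta|pn]; first exact: main pn hu.
by exists 1; split=> // u0 u hu _ delta; apply: main hu; rewrite pn.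
Qed.
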